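(* Let $\mathbb{SU}=\prod_{n=1}^\infty SU(n)$. For a comeager set of $G\in\mathcal{S}(\mathbb{SU})$, $G$ is homeomorphic to $G^\circ\times C$, where $C$ is the Cantor set, and $G^\circ$ is a nontrivial connected group that is not a Lie group.
   Context: $\mathbb{SU}$ carries the product topology, metrized by $d(x,y)=\sum_n 2^{-n}d_n(x(n),y(n))$ where $d_n\le 1$ is a biinvariant metric on $SU(n)$. $\mathcal{S}(\mathbb{SU})$ is the set of nonempty compact subgroups of $\mathbb{SU}$ with the Hausdorff metric induced by $d$. $G^\circ$ is the connected component of the identity of $G$. *)

(* Defs.v *)
From HB Require Import structures.
From mathcomp Require Import all_boot all_order all_algebra.
From mathcomp Require Import sesquilinear spectral complex.
From mathcomp Require Import all_classical all_reals all_analysis.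
From mathcomp Require Import lra.

Set Implicit Arguments.
Unset Strict Implicit.
Unset Printing Implicit Defensive.

Import Order.TTheory GRing.Theory Num.Theory.
Import numFieldNormedType.Exports.

Local Open Scope classical_set_scope.
Local Open Scope ring_scope.

Definition homeomorphic (X Y : topologicalType) :=
  exists (f : X -> Y) (g : Y -> X),
    [/\ continuous f, continuous g, cancel f g & cancel g f].

Definition nowhere_dense (X : topologicalType) (A : set X) :=
  (closure A)° = set0.

Definition meager (X : topologicalType) (A : set X) :=
  exists2 F : (set X)^nat, forall n, nowhere_dense (F n) & A `<=` \bigcup_n F n.

Definition comeager (X : topologicalType) (A : set X) := meager (~` A).

Section hausdorff_distance.
Context {R : realType} (T : metricType R).
Implicit Types (x y : T) (A B C : set T).

Definition dist_to x A : R := inf [set mdist x a | a in A].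

Definition excess A B : R := sup [set dist_to a B | a in A].

Definition hausdorff_dist A B : R := Num.max (excess A B) (excess B A).

Definition nonempty_compact : set (set T) :=
  [set A | A !=set0 /\ compact A].

Let dist_to_lb x A : has_lbound [set mdist x a | a in A].
Proof. by exists 0 => _ [a _ <-]; exact: mdist_ge0. Qed.

Let dist_to_le x A a : A a -> dist_to x A <= mdist x a.
Proof. by move=> Aa; apply: ge_inf; [exact: dist_to_lb|exists a]. Qed.

Let dist_to_ge0 x A : A !=set0 -> 0 <= dist_to x A.
Proof.
move=> [a Aa]; apply: lb_le_inf; first by exists (mdist x a), a.
by move=> _ [b _ <-]; exact: mdist_ge0.
Qed.

Let dist_to_adherent x A (e : R) : A !=set0 -> 0 < e ->
  exists2 a, A a & mdist x a < dist_to x A + e.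
Proof.
move=> [a Aa] e0.
have [|_ [b Ab <-] ?] := @inf_adherent _ [set mdist x a | a in A] e e0.
  by split; [exists (mdist x a), a|exact: dist_to_lb].
by exists b.
Qed.

Let compact_bounded A y : compact A -> exists M : R,
  forall a, A a -> mdist a y <= M.
Proof.
move=> /compact_near_coveringP/(_ nat \oo (fun n a => mdist a y <= n%:R)).
case=> [x Ax|N _ /(_ N) H]; last by exists N%:R => a; exact: H (leqnn N) a.
exists (ball x 1, [set n | mdist x y + 1 <= n%:R]) => /=.
  split; first exact: nbhsx_ballx.
  exact: nbhs_infty_ger.
move=> [a n] [/= xa]; apply: le_trans.
rewrite (le_trans (metric_triangle _ x _))// addrC lerD2l metric_sym ltW//.
by move: xa; rewrite ballEmdist.
Qed.

Let dist_to_le_excess A B a : nonempty_compact A -> nonempty_compact B ->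
  A a -> dist_to a B <= excess A B.
Proof.
move=> [A0 cA] [[b Bb] cB] Aa; apply: ub_le_sup; last by exists a.
have [M AM] := compact_bounded b cA.
by exists M => _ [c Ac <-]; exact: le_trans (dist_to_le _ Bb) (AM _ Ac).
Qed.

Let excess_le A B (e : R) : A !=set0 ->
  (forall a, A a -> dist_to a B <= e) -> excess A B <= e.
Proof.
move=> [a Aa] AB; apply: ge_sup; first by exists (dist_to a B), a.
by move=> _ [b Ab <-]; exact: AB.
Qed.

Let excess_triangle A B C : nonempty_compact A -> nonempty_compact B ->
  nonempty_compact C -> excess A C <= excess A B + excess B C.
Proof.
move=> cA cB cC; apply: excess_le => [|a Aa]; first by case: cA.
apply/ler_addgt0Pr => e e0; have [b Bb ab] := dist_to_adherent a cB.1 e0.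
have [||c Cc bc] := @dist_to_adherent b C (dist_to a B + e - mdist a b).
- by case: cC.
- by rewrite subr_gt0.
have := dist_to_le_excess cA cB Aa; have := dist_to_le_excess cB cC Bb.
have := dist_to_le a Cc; have := metric_triangle a b c.
move: ab bc; lra.
Qed.

Let excess_closed A B : nonempty_compact A -> nonempty_compact B ->
  excess A B <= 0 -> A `<=` B.
Proof.
move=> cA cB AB0 a Aa.
have /closure_id -> : closed B.
  by apply: compact_closed; [exact: metric_hausdorff|case: cB].
move=> U /nbhs_ballP[e /= e0 eU].
have [b Bb ab] := dist_to_adherent a cB.1 e0.
exists b; split => //; apply: eU; rewrite ballEmdist/=.
have := dist_to_le_excess cA cB Aa; move: ab AB0; lra.
Qed.

Definition compacts : Type := nonempty_compact.

HB.instance Definition _ := Choice.on compacts.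

Implicit Types K L M : compacts.

Let hdist K L := hausdorff_dist (\val K) (\val L).

Let cptP K : nonempty_compact (\val K).
Proof. exact: set_valP. Qed.

Let hdistxx K : hdist K K = 0.
Proof.
rewrite /hdist /hausdorff_dist maxxx; apply/eqP; rewrite eq_le; apply/andP; split.
  apply: excess_le => [|a Ka]; first by case: (cptP K).
  by rewrite -(mdistxx a); exact: dist_to_le.
have [[a Ka] _] := cptP K.
apply: le_trans (dist_to_le_excess (cptP K) (cptP K) Ka).
by apply: dist_to_ge0; exists a.
Qed.

Let hdist_positivity K L : hdist K L = 0 -> K = L.
Proof.
move=> KL0; have : hdist K L <= 0 by rewrite KL0.
rewrite /hdist /hausdorff_dist ge_max => /andP[KL LK]; apply: val_inj.
by apply/seteqP; split; apply: excess_closed.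
Qed.

Let hdist_sym K L : hdist K L = hdist L K.
Proof. exact: maxC. Qed.

Let hdist_triangle L K M : hdist K M <= hdist K L + hdist L M.
Proof.
rewrite {1}/hdist /hausdorff_dist ge_max; apply/andP; split.
- apply: le_trans (excess_triangle (cptP K) (cptP L) (cptP M)) _.
  by apply: lerD; rewrite le_max lexx.
- apply: le_trans (excess_triangle (cptP M) (cptP L) (cptP K)) _.
  by rewrite addrC; apply: lerD; rewrite le_max lexx orbT.
Qed.

HB.instance Definition _ :=
  isMetric.Build R compacts hdistxx hdist_positivity hdist_sym hdist_triangle.

End hausdorff_distance.

#[short(type="preTopologicalGroupType")]
HB.structure Definition PreTopologicalGroup :=
  {G of Topological G & Group G}.

Definition subgroup (G : groupType) (H : set G) :=
  [/\ H 1%g, forall x y, H x -> H y -> H (x * y)%g & forall x, H x -> H x^-1%g].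

Definition subgroup_type (G : groupType) (H : set G) (gH : subgroup H) : Type :=
  H.

Section subgroup_type.
Context (G : preTopologicalGroupType) (H : set G) (gH : subgroup H).

HB.instance Definition _ :=
  Topological.copy (subgroup_type gH) (H : Type).
HB.instance Definition _ := SubType.copy (subgroup_type gH) {x | x \in H}.

Let subgroup_closed : group_closed (mem H).
Proof.
case: gH => H1 HM HV; split=> [|x y]; rewrite !inE // => Hx Hy.
by apply: HM => //; exact: HV.
Qed.

HB.instance Definition _ :=
  SubChoice_isSubGroup.Build G (mem H) (subgroup_type gH) subgroup_closed.

End subgroup_type.

Section lie_group.
Context (R : realType).

(* [f] is C^oo on the open set [U]: all its iterated directional derivatives
   are differentiable on [U]. *)
Definition smooth_on (V W : normedModType R) (U : set V) (f : V -> W) :=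
  forall (vs : seq V) (x : V), U x ->
    differentiable (foldr (fun v g => 'D_v g) f vs) x.

(* Only the values of [chart_map] on [chart_dom] and of [chart_inv] on the
   image of [chart_dom] matter. *)
Record chart (G : topologicalType) (n : nat) := Chart {
  chart_dom : set G ;
  chart_map : G -> 'rV[R]_n ;
  chart_inv : 'rV[R]_n -> G ;
  chart_open_dom : open chart_dom ;
  chart_open_image : open (chart_map @` chart_dom) ;
  chart_mapK : {in chart_dom, cancel chart_map chart_inv} ;
  chart_map_continuous : {within chart_dom, continuous chart_map} ;
  chart_inv_continuous :
    {within chart_map @` chart_dom, continuous chart_inv} }.

Definition smooth_atlas (G : topologicalType) n (atlas : set (chart G n)) :=
  \bigcup_(c in atlas) chart_dom c = [set: G] /\
  forall c c', atlas c -> atlas c' ->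
    smooth_on (chart_map c @` (chart_dom c `&` chart_dom c'))
      (chart_map c' \o chart_inv c).

Definition is_lie_group (G : preTopologicalGroupType) :=
  [/\ hausdorff_space G, @second_countable G,
    continuous (fun x : G * G => (x.1 * x.2)%g),
    continuous (fun x : G => x^-1%g) &
    exists n (atlas : set (chart G n)), [/\ smooth_atlas atlas,
      forall a b c, atlas a -> atlas b -> atlas c ->
        smooth_on
          [set u : 'rV[R]_n * 'rV[R]_n |
            [/\ (chart_map a @` chart_dom a) u.1,
                (chart_map b @` chart_dom b) u.2 &
                chart_dom c (chart_inv a u.1 * chart_inv b u.2)%g]]
          (fun u => chart_map c (chart_inv a u.1 * chart_inv b u.2)%g) &
      forall a c, atlas a -> atlas c ->
        smooth_on
          [set u : 'rV[R]_n | (chart_map a @` chart_dom a) u /\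
            chart_dom c (chart_inv a u)^-1%g]
          (fun u => chart_map c (chart_inv a u)^-1%g)]].

End lie_group.

HB.instance Definition _ (R : realType) :=
  PseudoPointedMetric.copy R[i] R[i]^o.

Section special_unitary.
Context (R : realType) (n : nat).

Definition SU_set : set 'M[R[i]]_n := [set A | A \is unitarymx /\ \det A = 1].

Definition SU : Type := SU_set.

HB.instance Definition _ := Topological.copy SU (SU_set : Type).

Let SUP (A : SU) : SU_set (\val A). Proof. exact: set_valP. Qed.

Let SU_mul_subproof (A B : SU) : SU_set (\val A *m \val B).
Proof.
have [[uA dA] [uB dB]] := (SUP A, SUP B).
by split; [exact: mul_unitarymx|rewrite det_mulmx dA dB mulr1].
Qed.

Let SU_one_subproof : SU_set 1%:M.
Proof.
split; last exact: det1.
by apply/unitarymxP; rewrite trmx1 map_mx1 mulmx1.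
Qed.

Let SU_inv_subproof (A : SU) : SU_set (invmx (\val A)).
Proof.
have [uA dA] := SUP A; split; last by rewrite det_inv dA invr1.
by rewrite invmx_unitary// trmxC_unitary.
Qed.

Definition SU_mul (A B : SU) : SU := SigSub (mem_set (SU_mul_subproof A B)).
Definition SU_one : SU := SigSub (mem_set SU_one_subproof).
Definition SU_inv (A : SU) : SU := SigSub (mem_set (SU_inv_subproof A)).

Let SU_mulA : associative SU_mul.
Proof. by move=> A B C; apply: val_inj; exact: mulmxA. Qed.

Let SU_mul1 : left_id SU_one SU_mul.
Proof. by move=> A; apply: val_inj; exact: mul1mx. Qed.

Let SU_1mul : right_id SU_one SU_mul.
Proof. by move=> A; apply: val_inj; exact: mulmx1. Qed.

Let SU_mulV : left_inverse SU_one SU_inv SU_mul.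
Proof.
move=> A; apply: val_inj; apply: mulVmx.
by apply: unitarymx_unit; case: (SUP A).
Qed.

Let SU_Vmul : right_inverse SU_one SU_inv SU_mul.
Proof.
move=> A; apply: val_inj; apply: mulmxV.
by apply: unitarymx_unit; case: (SUP A).
Qed.

HB.instance Definition _ :=
  isGroup.Build SU SU_mulA SU_mul1 SU_1mul SU_mulV SU_Vmul.

End special_unitary.

Record biinvariant_metric (R : realType) (G : preTopologicalGroupType) :=
  BiinvariantMetric {
    bidist :> G -> G -> R ;
    bidistxx : forall x, bidist x x = 0 ;
    bidist_positivity : forall x y, bidist x y = 0 -> x = y ;
    bidist_sym : forall x y, bidist x y = bidist y x ;
    bidist_triangle : forall y x z, bidist x z <= bidist x y + bidist y z ;
    bidist_mull : forall z x y, bidist (z * x)%g (z * y)%g = bidist x y ;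
    bidist_mulr : forall z x y, bidist (x * z)%g (y * z)%g = bidist x y ;
    bidist_nbhsE : forall x (A : set G),
      nbhs x A <-> exists2 e : R, 0 < e & [set y | bidist x y < e] `<=` A ;
    bidist_le1 : forall x y, bidist x y <= 1 }.

Section product_of_special_unitary.
Context (R : realType).

(* The factor of index [n] is SU(n+1), so that the product runs over all SU(n)
   with n >= 1. *)
Definition prodSU (d : forall n, biinvariant_metric R (SU R n.+1)) : Type :=
  prod_topology (fun n => SU R n.+1 : topologicalType).

Context (d : forall n, biinvariant_metric R (SU R n.+1)).

HB.instance Definition _ := Topological.copy (prodSU d)
  (prod_topology (fun n => SU R n.+1 : topologicalType)).

Definition prodSU_dist (x y : prodSU d) : R :=
  limn (series (fun n => 2^-1 ^+ n.+1 * d n (x n) (y n))).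

Let dist := prodSU_dist.

Let term (x y : prodSU d) : R^nat := fun n => 2^-1 ^+ n.+1 * d n (x n) (y n).

Let bidist_ge0 n (x y : SU R n.+1) : 0 <= d n x y.
Proof.
have := bidist_triangle (d n) y x x.
by rewrite bidistxx (bidist_sym _ y x) -mulr2n pmulrn_lge0.
Qed.

Let term_ge0 x y n : 0 <= term x y n.
Proof. by rewrite mulr_ge0 ?exprn_ge0 ?invr_ge0. Qed.

Let term_le x y n : term x y n <= geometric 2^-1 2^-1 n.
Proof.
by rewrite /term /= -exprS ler_piMr ?bidist_le1// exprn_ge0 ?invr_ge0.
Qed.

Let half_lt1 : `|2^-1 : R| < 1.
Proof. by rewrite ger0_norm ?invr_ge0// invf_lt1// ltr1n. Qed.

Let is_cvg_term x y : cvgn (series (term x y)).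
Proof.
apply: (series_le_cvg (term_ge0 x y) _ (term_le x y)).
  by move=> n; rewrite /= mulr_ge0 ?exprn_ge0 ?invr_ge0.
exact: is_cvg_geometric_series.
Qed.

Let distxx x : dist x x = 0.
Proof.
rewrite /dist /prodSU_dist (_ : series _ = cst 0) ?lim_cst//.
by apply/funext => n; rewrite /series/= big1// => i _; rewrite bidistxx mulr0.
Qed.

Let dist_term x y n : term x y n <= dist x y.
Proof.
apply: (@le_trans _ _ (series (term x y) n.+1)).
  by rewrite seriesSr lerDr; apply: sumr_ge0.
apply: nondecreasing_cvgn_le; last exact: is_cvg_term.
by apply/nondecreasing_seqP => k; rewrite seriesSr lerDl.
Qed.

Let bidist_lt x y n (e : R) : dist x y < 2^-1 ^+ n.+1 * e -> d n (x n) (y n) < e.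
Proof.
move=> /(le_lt_trans (dist_term x y n)).
by rewrite /term ltr_pM2l// exprn_gt0 ?invr_gt0.
Qed.

Let dist_ge0 x y : 0 <= dist x y.
Proof. exact: le_trans (term_ge0 x y 0%N) (dist_term x y 0%N). Qed.

Let dist_positivity x y : dist x y = 0 -> x = y.
Proof.
move=> xy0; apply: functional_extensionality_dep => n.
apply: (bidist_positivity (b := d n)); apply/eqP; rewrite eq_le bidist_ge0 andbT.
by have := dist_term x y n; rewrite xy0 /term pmulr_rle0.
Qed.

Let dist_sym x y : dist x y = dist y x.
Proof.
rewrite /dist /prodSU_dist; congr (limn (series _)).
by apply/funext => n; rewrite bidist_sym.
Qed.

Let dist_triangle y x z : dist x z <= dist x y + dist y z.
Proof.
rewrite /dist /prodSU_dist -limD; try exact: is_cvg_term.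
apply: ler_lim; first exact: is_cvg_term.
  by apply: is_cvgD; exact: is_cvg_term.
apply: nearW => n; rewrite /series /=.
rewrite [leRHS](_ : _ = \sum_(0 <= i < n) (term x y i + term y z i)); last first.
  by rewrite big_split.
apply: ler_sum => i _.
by rewrite -mulrDr ler_pM2l ?bidist_triangle// exprn_gt0 ?invr_gt0.
Qed.

Let dist_le_tail x y N (e : R) : 0 <= e ->
  (forall n, (n < N)%N -> d n (x n) (y n) <= e) -> dist x y <= e + 2^-1 ^+ N.
Proof.
move=> e0 xye.
pose u : R^nat := fun n => geometric (2^-1 * e) 2^-1 n.
pose v : R^nat := fun n => if (n < N)%N then 0 else geometric 2^-1 2^-1 n.
have half n : \sum_(0 <= i < n) 2^-1 ^+ i.+1 = 1 - 2^-1 ^+ n :> R.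
  elim: n => [|n IH]; first by rewrite big_geq// expr0 subrr.
  by rewrite big_nat_recr//= IH exprS; lra.
apply: limr_le; first exact: is_cvg_term.
apply: nearW => n; rewrite /series /=.
have h0 k : 0 <= 2^-1 ^+ k :> R by rewrite exprn_ge0 ?invr_ge0.
have [nN|Nn] := leqP n N.
  apply: (@le_trans _ _ (\sum_(0 <= i < n) 2^-1 ^+ i.+1 * e)).
    rewrite !big_nat; apply: ler_sum => i /= iN.
    by rewrite ler_wpM2l// xye// (leq_trans iN).
  rewrite -mulr_suml half; have := h0 n; have := h0 N.
  move: e0; nra.
rewrite (big_cat_nat (n := N))//= 1?ltnW//; apply: lerD.
  apply: (@le_trans _ _ (\sum_(0 <= i < N) 2^-1 ^+ i.+1 * e)).
    rewrite !big_nat; apply: ler_sum => i /= iN.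
    by rewrite ler_wpM2l// xye.
  rewrite -mulr_suml half; have := h0 N.
  move: e0; nra.
apply: (@le_trans _ _ (\sum_(N <= i < n) 2^-1 ^+ i.+1)).
  by apply: ler_sum => i _; rewrite ler_piMr ?bidist_le1.
have := half n; rewrite (big_cat_nat (n := N))//= 1?ltnW// half.
have := h0 n; lra.
Qed.

(* [prodSU_dist] metrizes the product topology, so that the metric structure
   below extends the product topology on [prodSU d] instead of replacing it. *)
Let dist_nbhsE (x : prodSU d) (A : set (prodSU d)) :
  nbhs x A <-> exists2 e : R, 0 < e & [set y | dist x y < e] `<=` A.
Proof.
pose B := filter_from [set e : R | 0 < e] (fun e => [set y | dist x y < e]).
have BF : Filter B.
  apply: filter_from_filter; first by exists 1 => /=.
  move=> e f /= e0 f0; exists (Num.min e f); first by rewrite /= lt_min e0.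
  by move=> y /=; rewrite lt_min => /andP[].
split; last first.
  case=> e e0 eA; apply: filterS eA _.
  have xF : Filter (nbhs x) by exact: (@nbhs_filter (prodSU d)).
  have e20 : 0 < e / 2 by rewrite divr_gt0.
  have [N _ /(_ N (leqnn N)) /= NE] := near_infty_natSinv_expn_lt (PosNum e20).
  have : \forall y \near x, forall i : 'I_N,
      d i (x i) ((y : prodSU d) i) < e / 2.
    apply: (@filter_forall _ _ (fun (i : 'I_N) (y : prodSU d) =>
      d i (x i) (y i) < e / 2) (nbhs x) _) => i.
    apply: (@proj_continuous _ (fun n => SU R n.+1 : topologicalType) i x
      [set z | d i (x i) z < e / 2]).
    by apply/(bidist_nbhsE (d i)); exists (e / 2).
  apply: filterS => y xy /=.
  apply: (@le_lt_trans _ _ (e / 2 + 2^-1 ^+ N)).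
    apply: dist_le_tail; first exact: ltW.
    by move=> n nN; apply: ltW; exact: xy (Ordinal nN).
  by move: NE; rewrite div1r -exprVn; lra.
suff: (B : set_system (prod_topology _)) -->
  (x : prod_topology (fun n => SU R n.+1 : topologicalType)) by exact.
apply/cvg_sup => n U.
rewrite (@nbhsE (initial_topology _)) => -[V [[W oW <-] Wx]] /filterS; apply.
have /(bidist_nbhsE (d n))[e e0 eW] : nbhs (x n) W.
  by apply: open_nbhs_nbhs.
exists (2^-1 ^+ n.+1 * e); first by rewrite /= mulr_gt0.
by move=> y /bidist_lt; exact: eW.
Qed.

Let dball (x : prodSU d) (e : R) : set (prodSU d) := [set y | dist x y < e].

Let dball_center x (e : R) : 0 < e -> dball x e x.
Proof. by rewrite /dball /= distxx. Qed.

Let dball_sym x y (e : R) : dball x e y -> dball y e x.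
Proof. by rewrite /dball /= dist_sym. Qed.

Let dball_triangle x y z (e f : R) :
  dball x e y -> dball y f z -> dball x (e + f) z.
Proof.
by move=> xy yz; rewrite /dball /= (le_lt_trans (dist_triangle y _ _))// ltrD.
Qed.

Let nbhs_dist : nbhs = nbhs_ (entourage_ dball).
Proof.
apply/funext => x; apply/seteqP; split=> A.
  move=> /dist_nbhsE[e e0 eA].
  exists [set xy | dball xy.1 e xy.2]; first by exists e.
  by move=> y /xsectionP; exact: eA.
move=> [E [e /= e0 eE] EA]; apply/dist_nbhsE; exists e => // y xy.
by apply: EA; apply/xsectionP; exact: eE.
Qed.

Let ent_filter : Filter (entourage_ dball).
Proof.
apply: filter_from_filter; first by exists 1 => /=.
move=> e f /= e0 f0; exists (Num.min e f); first by rewrite /= lt_min e0.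
by move=> [y z]; rewrite /dball /= lt_min => /andP[].
Qed.

Let ent_diagonal E : entourage_ dball E -> diagonal `<=` E.
Proof.
move=> [e e0 eE] xy xyE; apply: eE => /=; rewrite (_ : xy.1 = xy.2)//.
exact: dball_center.
Qed.

Let ent_inv E : entourage_ dball E -> entourage_ dball E^-1%relation.
Proof.
by move=> [e e0 eE]; exists e => // -[x y] /dball_sym; exact: (eE (y, x)).
Qed.

Let ent_split E : entourage_ dball E ->
  exists2 F, entourage_ dball F & (F \; F `<=` E)%relation.
Proof.
move=> [e /= e0 eE]; exists [set xy | dball xy.1 (e / 2) xy.2].
  by exists (e / 2) => //=; rewrite divr_gt0.
move=> xy [z xz zy]; apply: eE => /=; rewrite [e]splitr.
exact: dball_triangle zy.
Qed.

HB.instance Definition _ := Nbhs_isUniform_mixin.Build (prodSU d)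
  ent_filter ent_diagonal ent_inv ent_split nbhs_dist.

HB.instance Definition _ := Uniform_isPseudoMetric.Build R (prodSU d)
  dball_center dball_sym dball_triangle erefl.

HB.instance Definition _ := @PseudoMetric_isMetric.Build R (prodSU d)
  prodSU_dist dist_ge0 dist_positivity (fun _ _ => erefl).

Definition prodSU_mul (x y : prodSU d) : prodSU d := fun n => (x n * y n)%g.
Definition prodSU_one : prodSU d := fun n => 1%g.
Definition prodSU_inv (x : prodSU d) : prodSU d := fun n => (x n)^-1%g.

Let prodSU_mulA : associative prodSU_mul.
Proof.
by move=> x y z; apply: functional_extensionality_dep => n; exact: mulgA.
Qed.

Let prodSU_mul1 : left_id prodSU_one prodSU_mul.
Proof. by move=> x; apply: functional_extensionality_dep => n; exact: mul1g. Qed.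

Let prodSU_1mul : right_id prodSU_one prodSU_mul.
Proof. by move=> x; apply: functional_extensionality_dep => n; exact: mulg1. Qed.

Let prodSU_mulV : left_inverse prodSU_one prodSU_inv prodSU_mul.
Proof. by move=> x; apply: functional_extensionality_dep => n; exact: mulVg. Qed.

Let prodSU_Vmul : right_inverse prodSU_one prodSU_inv prodSU_mul.
Proof. by move=> x; apply: functional_extensionality_dep => n; exact: mulgV. Qed.

HB.instance Definition _ := isGroup.Build (prodSU d)
  prodSU_mulA prodSU_mul1 prodSU_1mul prodSU_mulV prodSU_Vmul.

(* A subspace of [compacts (prodSU d)]: its topology comes from the Hausdorff
   metric, not from a topology on sets of points. *)
Definition compact_subgroups : Type :=
  [set K : compacts (prodSU d) | subgroup (\val K)].

HB.instance Definition _ := Topological.copy compact_subgroups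
  ([set K : compacts (prodSU d) | subgroup (\val K)] : Type).

Definition subgroup_of (G : compact_subgroups) : set (prodSU d) :=
  \val (\val G).

End product_of_special_unitary.

(* Main.v *)
(** For a compact subgroup [G] write [C] for its identity component.

    [G] is homeomorphic to [C x G/C]: the components of [G] are the cosets of [C],
    and Michael's selection theorem for zero-dimensional spaces gives a continuous
    choice of one point in each of them.  The set of chosen points is compact and
    zero-dimensional, and it is perfect, hence a Cantor set, unless [C] is open.
    Replacing [G] by its projection to finitely many factors times [{1, -1}] in a
    later factor shows that generically [C] is not open.

    Generically [C] meets the kernel of every projection to finitely many factors in
    a nontrivial connected group.  In particular [C] has arbitrarily small
    nontrivial subgroups, so it is not a Lie group.  To see this, replace [G] by its
    projection to the first factors times a later factor SU(n), and let [H] be a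
    compact subgroup near the result.  Elements of [H] that are close to 1 in the
    first factors and close to an arbitrary element of SU(n) have commutators that are
    quadratically small in the first factors but can be kept away from the scalars in
    SU(n), so [H] contains elements that are trivial in the first factors and not
    scalar in SU(n).  Commutators of these with elements of [H] that are near 1 in
    SU(n) give elements of the kernel whose images in SU(n) are nontrivial and
    arbitrarily small, which rules out that the kernel is totally disconnected,
    because SU(n) has no small subgroups. *)
Require Import Defs.
From HB Require Import structures.
From mathcomp Require Import all_boot all_order all_algebra.
From mathcomp Require Import sesquilinear spectral complex perm.
From mathcomp Require Import all_classical all_reals all_analysis.
From mathcomp Require Import ring lra.

Set Implicit Arguments.
Unset Strict Implicit.
Unset Printing Implicit Defensive.

Import Order.TTheory GRing.Theory Num.Theory.
Import numFieldNormedType.Exports.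
Import Normc ComplexField.

Local Open Scope classical_set_scope.
Local Open Scope ring_scope.
Local Open Scope sesquilinear_scope.

(** * Components of compact metric spaces *)

Section compact_metric.
Context {R : realType} (T : metricType R).
Implicit Types (K U V : set T) (x y z : T).

Lemma nbhs_mdist x U :
  nbhs x U <-> exists2 e : R, 0 < e & forall y, mdist x y < e -> U y.
Proof.
split=> [/nbhs_ballP[e e0 eU]|[e e0 eU]].
  by exists e => // y xy; apply: eU; rewrite ballEmdist.
by apply/nbhs_ballP; exists e => // y; rewrite ballEmdist => /eU.
Qed.

Lemma open_thickening (A : set T) (e : R) :
  open [set y | exists2 a, A a & mdist a y < e].
Proof.
rewrite openE => y [a Aa ay]; apply/nbhs_mdist.
exists (e - mdist a y); first by rewrite subr_gt0.
by move=> z yz; exists a => //; have := metric_triangle a y z; move: yz; lra.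
Qed.

Lemma compact_seq_cluster K (u : nat -> T) : compact K -> (forall n, K (u n)) ->
  exists2 w, K w & forall (e : R) N, 0 < e -> exists2 k, (N <= k)%N & mdist (u k) w < e.
Proof.
move=> cK Ku; have [|w [Kw cw]] := cK (u @ \oo) _.
  by exists 0%N => // n _; exact: Ku.
exists w => // e N e0.
have [||_ [[k /= Nk <-] wk]] := cw (u @` [set k | (N <= k)%N]) [set y | mdist w y < e].
- by exists N => // k Nk; exists k.
- by apply/nbhs_mdist; exists e.
by exists k => //; rewrite metric_sym.
Qed.

Lemma compact_finite_cover (X : topologicalType) (K : set X) (I : choiceType)
    (D : set I) (f : I -> set X) : compact K -> (forall i, D i -> open (f i)) ->
  K `<=` cover D f -> finite_subset_cover D f K.
Proof.
have [[x Kx]|K0] := pselect (K !=set0); last first.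
  by exists (finmap.fset0) => // x Kx; case: K0; exists x.
(* A point of [K] serves as base point; an empty [K] was covered by the empty family. *)
pose X' : ptopologicalType := 
  HB.pack (Topological.sort X) (isPointed.Build (Topological.sort X) x).
by move=> cK; have := @compact_cover X'; rewrite predeqE => /(_ K) [+ _]; exact.
Qed.

Lemma exp_half_lt (M e : R) : 0 < e -> exists k, M * 2^-1 ^+ k < e.
Proof.
move=> e0; have [M0|M0] := leP M 0.
  by exists 0%N; rewrite expr0 mulr1 (le_lt_trans M0).
have eM : 0 < e / M by rewrite divr_gt0.
have [k _ /(_ k (leqnn k)) /= kE] := near_infty_natSinv_expn_lt (PosNum eM).
by exists k; move: kE; rewrite div1r -exprVn ltr_pdivlMr// mulrC.
Qed.

(** Otherwise points of [K] and [L] come arbitrarily close, and a cluster point of the former lies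
    in [K] and, [L] being closed, also in [L]. *)
Lemma compact_disjoint_mdist K L : compact K -> compact L -> K `&` L = set0 ->
  exists2 r : R, 0 < r & forall a b, K a -> L b -> r <= mdist a b.
Proof.
move=> cK cL KL; apply: contrapT => /forall2NP H.
have {}H n : exists p : T * T, [/\ K p.1, L p.2 & mdist p.1 p.2 < 2^-1 ^+ n].
  have [|/existsNP[a /existsNP[b /not_implyP[Ka /not_implyP[Lb ab]]]]] :=
    H (2^-1 ^+ n); first by rewrite exprn_gt0 ?invr_gt0.
  by exists (a, b); split => //=; rewrite ltNge; apply/negP.
have [p pP] := choice H.
have [|w Kw clw] := compact_seq_cluster (u := fun n => (p n).1) cK.
  by move=> n; have [] := pP n.
suff Lw : L w by have : (K `&` L) w by []; rewrite KL.
have /closure_id -> : closed L by apply: compact_closed => //; exact: metric_hausdorff.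
move=> B /nbhs_mdist[e e0 eB].
have [N NE] := @exp_half_lt 1 (e / 2) (divr_gt0 e0 (ltr0Sn _ 1)).
have [k Nk kE] := clw (e / 2) N (divr_gt0 e0 (ltr0Sn _ 1)).
have [_ Lk pk] := pP k; exists (p k).2; split => //; apply: eB.
have : 2^-1 ^+ k <= 2^-1 ^+ N :> R.
  by rewrite ler_wiXn2l// ?invr_ge0// invf_le1// ler1n.
have := metric_triangle w (p k).1 (p k).2; rewrite (metric_sym w (p k).1).
move: NE kE pk; lra.
Qed.

(** For [V] inside [K] this is a uniform form of being clopen in [K]: [V] and the rest of [K] are at
    distance at least [e]. *)
Definition saturated K (e : R) V :=
  forall y z, V y -> K z -> mdist y z < e -> V z.

(** The component meets [V] in a clopen set: the thickening of [V] by [e] shows that it is open, the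
    complement of the thickening of the rest of [K] that it is closed. *)
Lemma component_saturated_sub K x (e : R) V : 0 < e -> V x -> saturated K e V ->
  connected_component K x `<=` V.
Proof.
move=> e0 Vx sV; set Q := connected_component K x.
have QK : Q `<=` K by exact: connected_component_sub.
have [Kx|Kx] := pselect (K x); last by rewrite /Q connected_component_out.
have : connected Q by exact: component_connected.
move=> /(_ (Q `&` V)) QE; suff <- : Q `&` V = Q by move=> y [].
apply: QE; first by exists x; split => //; exact: connected_component_refl.
- exists [set y | exists2 a, V a & mdist a y < e]; first exact: open_thickening.
  apply/seteqP; split=> y [Qy]; first by move=> Vy; split => //; exists y; rewrite ?mdistxx.
  by move=> [a Va ay]; split => //; apply: sV ay => //; exact: QK.
- exists (~` [set y | exists2 a, (K `\` V) a & mdist a y < e]).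
    exact/open_closedC/open_thickening.
  apply/seteqP; split=> y [Qy].
    move=> Vy; split => // -[a [Ka Va] ay]; apply: Va.
    by apply: (sV y) => //; rewrite metric_sym.
  move=> Vy; split => //; apply: contrapT => nVy; apply: Vy; exists y.
    by split => //; exact: QK.
  by rewrite mdistxx.
Qed.

(* The points reachable from [x] inside [K] by chains with steps shorter than [e]. *)
Let chain K x (e : R) : set T :=
  [set y | K y /\ forall V, V x -> saturated K e V -> V y].

Let chain_saturated K x e : saturated K e (chain K x e).
Proof.
move=> y z [Ky yV] Kz yz; split => // V Vx sV.
by apply: (sV y) => //; apply: yV.
Qed.

Let chain_le K x (e f : R) : e <= f -> chain K x e `<=` chain K x f.
Proof.
move=> ef y [Ky yV]; split => // V Vx sV; apply: yV => // a b Va Kb ab.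
by apply: (sV a) => //; rewrite (lt_le_trans ab).
Qed.

Let chain_refl K x e : K x -> chain K x e x.
Proof. by move=> Kx; split. Qed.

Let quasi K x : set T := [set y | forall e : R, 0 < e -> chain K x e y].

(** Points outside [U] on ever finer chains would cluster at some [w]. One more short step puts [w]
    in every chain component, hence in [U], although it is a limit of points outside the open set
    [U]. *)
Let chain_sub_open K x U : compact K -> open U ->
  quasi K x `<=` U -> exists2 e : R, 0 < e & chain K x e `<=` U.
Proof.
move=> cK oU QU; apply: contrapT => /forall2NP H.
have {}H n : exists y, chain K x (2^-1 ^+ n) y /\ ~ U y.
  have [|/existsNP[y /not_implyP[xy Uy]]] := H (2^-1 ^+ n).
    by rewrite exprn_gt0 ?invr_gt0.
  by exists y.
have [u uP] := choice H.
have [|w Kw clw] := compact_seq_cluster (u := u) cK.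
  by move=> n; have [[]] := uP n.
have Qw : quasi K x w.
  move=> e e0; have [N] := exp_half_lt 1 e0; rewrite mul1r => NE.
  have [k Nk kE] := clw e N e0; apply: (chain_saturated (y := u k)) kE => //.
  apply: (chain_le (e := 2^-1 ^+ k)); last by have [] := uP k.
  by apply: le_trans (ltW NE); rewrite ler_wiXn2l// ?invr_ge0// invf_le1// ler1n.
have : nbhs w U by apply: open_nbhs_nbhs; split => //; exact: QU.
move=> /nbhs_mdist[e e0 eU]; have [k _] := clw e 0%N e0.
by rewrite metric_sym => /eU; have [] := uP k.
Qed.

(** Thicken [A] and [B] by a third of their distance [r]. Fine chains stay in the two thickenings,
    and a step shorter than [r / 3] cannot pass from one to the other, so chains from [x] never
    reach [B]. *)
Let quasi_split K x (A B : set T) : compact K -> K x -> compact A -> compact B ->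
  A `&` B = set0 -> quasi K x = A `|` B -> A x -> B = set0.
Proof.
move=> cK Kx cA cB AB QAB Ax; have [r r0 rAB] := compact_disjoint_mdist cA cB AB.
pose NA := [set y | exists2 a, A a & mdist a y < r / 3].
pose NB := [set y | exists2 a, B a & mdist a y < r / 3].
have r3 : 0 < r / 3 by rewrite divr_gt0.
have [|y|e e0 eN] := @chain_sub_open K x (NA `|` NB) cK.
- by apply: openU; exact: open_thickening.
- by rewrite QAB => -[Ay|By]; [left|right]; exists y; rewrite ?mdistxx.
pose f := Num.min e (r / 3).
have f0 : 0 < f by rewrite lt_min e0.
have fe : f <= e by rewrite ge_min lexx.
have fr : f <= r / 3 by rewrite ge_min lexx orbT.
rewrite -subset0 => b Bb.
have Qb : quasi K x b by rewrite QAB; right.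
have [_ bV] := Qb f f0; suff [_ [a Aa ab]] : (chain K x f `&` NA) b.
  by have := rAB a b Aa Bb; move: r0 ab; lra.
apply: bV.
- by split; [exact: chain_refl|exists x; rewrite ?mdistxx].
- move=> y z [xy [a Aa ay]] Kz yz; split; first exact: chain_saturated yz.
  have /eN[//|[c Bc cz]] : chain K x e z.
    by apply: (chain_le fe); exact: chain_saturated yz.
  have := rAB a c Aa Bc; have := metric_triangle a y c.
  have := metric_triangle y z c; rewrite (metric_sym z c).
  by move: ay cz (lt_le_trans yz fr); lra.
Qed.

Let quasi_closed K x : compact K -> closed (quasi K x).
Proof.
move=> cK y cy; have cl : closed K by apply: compact_closed => //; exact: metric_hausdorff.
have Ky : K y.
  by apply: cl; apply: closureS cy => z /(_ 1 ltr01) [].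
move=> e e0; have [|z [xz yz]] := cy [set z | mdist y z < e].
  by apply/nbhs_mdist; exists e.
by apply: (chain_saturated (y := z)) => //; [exact: xz|rewrite metric_sym].
Qed.

Let quasi_sub K x : quasi K x `<=` K.
Proof. by move=> y /(_ 1 ltr01)[]. Qed.

Let quasi_connected K x : compact K -> K x -> connected (quasi K x).
Proof.
move=> cK Kx B [b Bb] [C1 oC1 BC1] [C2 cC2 BC2].
have cQ A : closed A -> compact (quasi K x `&` A).
  move=> cA; apply: (subclosed_compact _ cK); last by move=> y [/quasi_sub].
  by apply: closedI => //; exact: quasi_closed.
have cB : compact B by rewrite BC2; exact: cQ.
have cD : compact (quasi K x `&` ~` C1) by apply/cQ/open_closedC.
have BD : B `&` (quasi K x `&` ~` C1) = set0.
  by rewrite -subset0 {1}BC1 => y [[_ +] [_]].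
have QBD : quasi K x = B `|` (quasi K x `&` ~` C1).
  by rewrite {1}BC1 -setIUr setUCr setIT.
have Qx : quasi K x x by move=> e _; exact: chain_refl.
have [Bx|Dx] : (B `|` (quasi K x `&` ~` C1)) x by rewrite -QBD.
  by rewrite QBD (quasi_split cK Kx cB cD BD QBD Bx) setU0.
rewrite setIC in BD; rewrite setUC in QBD.
by have := quasi_split cK Kx cD cB BD QBD Dx => B0; rewrite B0 in Bb.
Qed.

(* In a compact metric space, components are intersections of chain components. *)
Lemma component_saturated_nbhs K x U : compact K -> K x -> open U ->
  connected_component K x `<=` U ->
  exists2 e : R, 0 < e & exists V, [/\ V x, V `<=` U, V `<=` K & saturated K e V].
Proof.
move=> cK Kx oU KU; have [|e e0 eU] := @chain_sub_open K x U cK oU.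
  apply: (subset_trans _ KU); apply: connected_component_max.
  - by move=> e _; apply: chain_refl.
  - exact: quasi_sub.
  - exact: quasi_connected.
exists e => //; exists (chain K x e).
by split; [exact: chain_refl|exact: eU|move=> y []|exact: chain_saturated].
Qed.

(** * Continuous selection of a point in each component *)

Section component_section.
Variables (G : set T) (M : R).
Hypothesis cG : compact G.
Hypothesis GM : forall x y, G x -> G y -> mdist x y < M.
(* lower semicontinuity of the decomposition into components *)
Hypothesis lsc : forall x y z (e : R), G x -> G y -> connected_component G x z ->
  mdist x y < e -> exists2 w, connected_component G y w & mdist z w < e.

Local Notation cc := (connected_component G).

Let locally_constant (s : T -> T) := exists2 e : R, 0 < e &
  forall x y, G x -> G y -> mdist x y < e -> s x = s y.

Let approx (r : R) (s : T -> T) := locally_constant s /\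
  forall x, G x -> exists2 y, cc x y & mdist (s x) y < r.

Let locally_constant_cc s x y : locally_constant s -> G x -> cc x y -> s x = s y.
Proof.
move=> [e e0 es] Gx xy.
suff /(_ _ xy)[] : cc x `<=` G `&` [set y | s x = s y] by [].
apply: (component_saturated_sub e0) => //.
move=> a b [Ga sa] Gb ab; split => //.
by rewrite /= sa; exact: es.
Qed.

(** For each [x] choose [y x] in its component within [r] of [s x]. By lower semicontinuity nearby
    components pass close to [y x]. Finitely many clopen neighbourhoods of components cover [G], and
    the first one that contains a point decides which [y x] it gets. *)
Let refine (r r' : R) (s : T -> T) : approx r s -> 0 < r' ->
  exists2 s', approx r' s' & forall x, G x -> mdist (s x) (s' x) < r.
Proof.
move=> [ls sr] r'0; have [e e0 es] := ls.
have /choice[y yP] : forall x, exists y, G x -> cc x y /\ mdist (s x) y < r.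
  move=> x; have [Gx|nGx] := pselect (G x); last by exists x.
  by have [y xy sy] := sr x Gx; exists y.
(* Within [e] of the component of [x] the map [s] keeps its value; within [r'], lower semicontinuity
   puts a point of the new component at distance below [r'] from [y x]. *)
pose U x := [set z | exists2 a, cc x a & mdist a z < Num.min e r'].
have m0 : 0 < Num.min e r' by rewrite lt_min e0.
have VP x : exists p : R * set T, G x -> [/\ 0 < p.1, p.2 x, p.2 `<=` U x,
    p.2 `<=` G & saturated G p.1 p.2].
  have [Gx|nGx] := pselect (G x); last by exists (0, set0).
  have [||f f0 [V [Vx VU VG sV]]] := @component_saturated_nbhs G x (U x) cG Gx.
  - exact: open_thickening.
  - by move=> z xz; exists z; rewrite ?mdistxx.
  by exists (f, V).
have [p {}VP] := choice VP.
pose V x := (p x).2.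
pose O x := [set z | exists2 a, V x a & mdist a z < (p x).1].
have OV x z : G x -> G z -> O x z -> V x z.
  by move=> Gx Gz [a Va az]; have [_ _ _ _ sV] := VP x Gx; exact: (sV a z).
have [||D DG GD] := compact_finite_cover cG (D := G) (f := O).
- by move=> x _; exact: open_thickening.
- move=> x Gx; exists x => //; have [f0 Vx _ _ _] := VP x Gx.
  by exists x; rewrite ?mdistxx.
(* The default value never occurs on [G], because the pieces indexed by [D] cover [G]. *)
pose pick_ z := nth z (finmap.enum_fset D) (find (fun x => `[< V x z >]) (finmap.enum_fset D)).
have pickP z : G z -> [/\ G (pick_ z) & V (pick_ z) z].
  move=> Gz; have [x /= xD Oxz] := GD z Gz.
  have hx : has (fun x => `[< V x z >]) (finmap.enum_fset D).
    apply/hasP; exists x => //; apply/asboolP/OV => //.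
    by have := DG _ xD; rewrite inE.
  split; last by apply/asboolP; exact: (nth_find z hx).
  by apply/set_mem/DG/mem_nth; rewrite -has_find.
exists (fun z => y (pick_ z)).
  split.
    (* The least of finitely many gaps: a shorter move changes membership in none of the pieces,
       hence not the index that is found. *)
    have : exists2 f : R, 0 < f & forall x, x \in finmap.enum_fset D -> f <= (p x).1.
      have : forall x, x \in finmap.enum_fset D -> 0 < (p x).1.
        by move=> x /DG/set_mem/VP[].
      elim: (finmap.enum_fset D) => [_|x l IH xl]; first by exists 1.
      have [|f f0 fl] := IH; first by move=> z zl; apply: xl; rewrite inE zl orbT.
      exists (Num.min f (p x).1) => [|z]; first by rewrite lt_min f0 xl// mem_head.
      by rewrite inE ge_min => /orP[/eqP->|/fl->]; rewrite ?lexx ?orbT.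
    move=> [f f0 fD]; exists f => // a b Ga Gb ab; congr (y _).
    have VE x : x \in finmap.enum_fset D -> `[< V x a >] = `[< V x b >].
      move=> xD; have [_ _ _ _ sV] := VP x (set_mem (DG _ xD)).
      apply/asboolP/asboolP => [Va|Vb].
        by apply: sV Va Gb _; rewrite (lt_le_trans ab)// fD.
      by apply: sV Vb Ga _; rewrite metric_sym (lt_le_trans ab)// fD.
    have fE : find (fun x => `[< V x a >]) (finmap.enum_fset D) =
      find (fun x => `[< V x b >]) (finmap.enum_fset D) by exact: eq_in_find.
    rewrite /pick_ fE; apply: set_nth_default; rewrite -fE -has_find.
    have [x /= xD Oxz] := GD a Ga; apply/hasP; exists x => //.
    by apply/asboolP/OV => //; apply/set_mem/DG.
  move=> z Gz; have [Gx Vz] := pickP z Gz.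
  have [_ _ /(_ _ Vz)[a xa az] _ _] := VP _ Gx.
  have [xy sy] := yP _ Gx.
  have Ga : G a by exact: connected_component_sub xa.
  have ay : cc a (y (pick_ z)).
    by rewrite -(same_connected_component xa).
  apply: lsc ay _ => //; apply: lt_le_trans az _.
  by rewrite ge_min lexx orbT.
move=> z Gz; have [Gx Vz] := pickP z Gz.
have [_ _ /(_ _ Vz)[a xa az] _ _] := VP _ Gx.
have [xy sy] := yP _ Gx.
have Ga : G a by exact: connected_component_sub xa.
rewrite -(es a z)//; first by rewrite -(locally_constant_cc ls Gx xa).
by apply: lt_le_trans az _; rewrite ge_min lexx.
Qed.

(* Michael's selection theorem for zero-dimensional spaces, applied to the space
   of components: locally constant approximate selections are refined and
   converge uniformly. *)
Lemma component_section : exists s : T -> T, [/\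
  forall x, G x -> cc x (s x),
  forall x y, G x -> cc x y -> s x = s y &
  forall e : R, 0 < e -> exists2 f : R, 0 < f &
    forall x y, G x -> G y -> mdist x y < f -> mdist (s x) (s y) < e].
Proof.
have [[x0 Gx0]|G0] := pselect (G !=set0); last first.
  have {}G0 x : ~ G x by move=> Gx; apply: G0; exists x.
  by exists id; split => [x /G0//|x y /G0//|e e0]; exists e => // x y /G0.
have M0 : 0 < M by rewrite (le_lt_trans (mdist_ge0 x0 x0))// GM.
(* [M] bounds the diameter, so a constant map is already an approximate selection with error
   [r 0]. *)
pose r k := M * 2^-1 ^+ k.
have r0 k : 0 < r k by rewrite mulr_gt0// exprn_gt0 ?invr_gt0.
have rS k : r k = r k.+1 + r k.+1 by rewrite /r exprS; lra.
have a0 : approx (r 0%N) (fun=> x0).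
  split; first by exists 1.
  move=> x Gx; exists x; first exact: connected_component_refl.
  by rewrite /r expr0 mulr1 GM.
have /choice[next nextP] : forall p : nat * (T -> T), exists s',
    approx (r p.1) p.2 -> approx (r p.1.+1) s' /\
    forall x, G x -> mdist (p.2 x) (s' x) < r p.1.
  move=> [k s]; have [ask|nask] := pselect (approx (r k) s); last by exists id.
  by have [s' ? ?] := refine ask (r0 k.+1); exists s'.
pose s := fix s k := if k is k'.+1 then next (k', s k') else (fun=> x0).
have sP k : approx (r k) (s k) by elim: k => [//|k IH]; exact: (nextP (k, s k) IH).1.
have sS k x : G x -> mdist (s k x) (s k.+1 x) < r k.
  by move=> Gx; exact: (nextP (k, s k) (sP k)).2.
(* Since [r k = 2 r k - 2 r k.+1], the bounds on the single steps telescope. *)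
have sD k j x : G x -> mdist (s k x) (s (k + j)%N x) <= r k + r k - r (k + j)%N - r (k + j)%N.
  move=> Gx; elim: j => [|j IH]; first by rewrite addn0 mdistxx; lra.
  rewrite addnS; have := sS (k + j)%N x Gx; have := rS (k + j)%N.
  by have := metric_triangle (s k x) (s (k + j)%N x) (s (k + j).+1 x); move: IH; lra.
(* The limit is obtained as a cluster point of points of the component close to [s k x], so that it
   lies in the component, which is closed. *)
have /choice[t tP] x : exists w, G x -> cc x w /\ forall k, mdist (s k x) w <= 4 * r k.
  have [Gx|nGx] := pselect (G x); last by exists x.
  have /choice[y yP] k : exists y, cc x y /\ mdist (s k x) y < r k.
    by have [_ /(_ _ Gx)[y ? ?]] := sP k; exists y.
  have ccx : compact (cc x).
    apply: (subclosed_compact _ cG); last exact: connected_component_sub.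
    by apply: component_closed; exact: (compact_closed (@metric_hausdorff _ T)).
  have [|w xw clw] := compact_seq_cluster (u := y) ccx; first by move=> k; have [] := yP k.
  exists w => _; split => // k.
  have [m km mE] := clw (r k) k (r0 k).
  have [_ ym] := yP m.
  have := sD k (m - k)%N x Gx; rewrite subnKC//.
  have := metric_triangle (s k x) (s m x) w; have := metric_triangle (s m x) (y m) w.
  by move: mE ym (r0 m) (r0 k); lra.
have tT k x y : G x -> G y -> s k x = s k y -> mdist (t x) (t y) <= 8 * r k.
  move=> Gx Gy sxy; have [_ /(_ k) tx] := tP x Gx; have [_ /(_ k) ty] := tP y Gy.
  have := metric_triangle (t x) (s k x) (t y); rewrite (metric_sym (t x) (s k x)).
  by rewrite sxy in tx *; move: tx ty; lra.
exists t; split => [x Gx|x y Gx xy|e e0].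
- by have [] := tP x Gx.
- have Gy : G y by exact: connected_component_sub xy.
  apply: mdist_positivity; apply/eqP; rewrite eq_le mdist_ge0 andbT.
  rewrite leNgt; apply/negP => d0; have [k kE] := exp_half_lt (8 * M) d0.
  have := tT k x y Gx Gy (locally_constant_cc (sP k).1 Gx xy).
  by rewrite /r; move: kE; lra.
- have [k kE] := exp_half_lt (8 * M) e0.
  have [[f f0 fs] _] := sP k; exists f => // x y Gx Gy xy.
  by have := tT k x y Gx Gy (fs _ _ Gx Gy xy); rewrite /r; move: kE; lra.
Qed.

End component_section.

End compact_metric.

(** * Unitary matrices *)

Section entrywise_norm.
Context {R : realType}.
Local Notation C := R[i].

Lemma norm_normc (x : C) : `|x| = (normc x)%:C%C.
Proof. by []. Qed.

Lemma normc_ge0 (x : C) : 0 <= normc x.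
Proof. by rewrite -lecR -norm_normc normr_ge0. Qed.

Lemma normc_conj (x : C) : normc (x^*) = normc x.
Proof. by apply: complexI; rewrite -!norm_normc norm_conjC. Qed.

Lemma normc_distC (x y : C) : normc (x - y) = normc (y - x).
Proof. by rewrite -opprB normcN. Qed.

Lemma normc_sum (I : finType) (F : I -> C) :
  normc (\sum_i F i) <= \sum_i normc (F i).
Proof.
elim/big_rec2 : _ => [|i y x _ xy]; first by rewrite normc0.
by apply: le_trans (le_normcD _ _) _; rewrite lerD2l.
Qed.

Lemma unimodular_normc (x : C) : x * x^* = 1 -> normc x = 1.
Proof.
rewrite -normCK => /eqP; rewrite norm_normc -rmorphXn /= => /eqP/complexI/eqP.
by rewrite sqrp_eq1 ?normc_ge0// => /eqP.
Qed.

(** This norm is real-valued and submultiplicative but not unitarily invariant: a unitary factor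
    costs the square of its size. *)
Definition l1 m n (A : 'M[C]_(m, n)) : R := \sum_i \sum_j normc (A i j).

Lemma l1_ge0 m n (A : 'M[C]_(m, n)) : 0 <= l1 A.
Proof. by do 2!apply: sumr_ge0 => ? _; exact: normc_ge0. Qed.

Lemma l1_entry m n (A : 'M[C]_(m, n)) i j : normc (A i j) <= l1 A.
Proof.
rewrite /l1 (bigD1 i)//= (bigD1 j)//= -addrA lerDl addr_ge0//.
  by apply: sumr_ge0 => ? _; exact: normc_ge0.
by do 2!apply: sumr_ge0 => ? _; exact: normc_ge0.
Qed.

Lemma l1_eq0 m n (A : 'M[C]_(m, n)) : l1 A <= 0 -> A = 0.
Proof.
move=> A0; apply/matrixP => i j; rewrite mxE; apply: eq0_normc.
by apply/eqP; rewrite eq_le normc_ge0 andbT (le_trans (l1_entry A i j)).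
Qed.

Lemma l1D m n (A B : 'M[C]_(m, n)) : l1 (A + B) <= l1 A + l1 B.
Proof.
rewrite -big_split; apply: ler_sum => i _; rewrite -big_split/=.
by apply: ler_sum => j _; rewrite mxE le_normcD.
Qed.

Lemma l1N m n (A : 'M[C]_(m, n)) : l1 (- A) = l1 A.
Proof. by do 2!apply: eq_bigr => ? _; rewrite mxE normcN. Qed.

Lemma l1B m n (A B : 'M[C]_(m, n)) : l1 (A - B) <= l1 A + l1 B.
Proof. by rewrite -(l1N B) l1D. Qed.

Lemma l1_distC m n (A B : 'M[C]_(m, n)) : l1 (A - B) = l1 (B - A).
Proof. by rewrite -opprB l1N. Qed.

Lemma l1M m n p (A : 'M[C]_(m, n)) (B : 'M[C]_(n, p)) :
  l1 (A *m B) <= l1 A * l1 B.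
Proof.
rewrite /l1 mulr_suml; apply: ler_sum => i _.
apply: (@le_trans _ _ (\sum_k \sum_j normc (A i j) * normc (B j k))).
  apply: ler_sum => k _; rewrite mxE; apply: le_trans (normc_sum _) _.
  by apply: ler_sum => j _; rewrite normcM.
rewrite exchange_big/= mulr_suml; apply: ler_sum => j _.
rewrite -mulr_sumr ler_wpM2l ?normc_ge0//.
rewrite (bigD1 j)//= lerDl.
by do 2!apply: sumr_ge0 => ? _; exact: normc_ge0.
Qed.

Lemma l1_trmxC m n (A : 'M[C]_(m, n)) : l1 (A^t*) = l1 A.
Proof.
rewrite /l1 exchange_big/=; apply: eq_bigr => i _; apply: eq_bigr => j _.
by rewrite !mxE normc_conj.
Qed.

Lemma unitarymxPl n (A : 'M[C]_n) : A \is unitarymx -> A *m A^t* = 1%:M.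
Proof. by move=> /unitarymxP. Qed.

Lemma unitarymxPr n (A : 'M[C]_n) : A \is unitarymx -> A^t* *m A = 1%:M.
Proof. by move=> /unitarymxP/mulmx1C. Qed.

Lemma row_norm_le1 n (v : 'rV[C]_n) i : v *m v^t* = 1%:M -> normc (v 0 i) <= 1.
Proof.
move=> /matrixP/(_ 0 0); rewrite !mxE eqxx/= => v1.
have : `|v 0 i| ^+ 2 <= 1.
  have -> : 1 = \sum_j v 0 j * (v^t*) j 0 by rewrite v1.
  rewrite (bigD1 i)//= !mxE -normCK lerDl; apply: sumr_ge0 => j _.
  by rewrite !mxE -normCK exprn_ge0.
by rewrite expr_le1// norm_normc -[1]/(1%:C%C) lecR.
Qed.

Lemma unitary_entry n (A : 'M[C]_n) i j : A \is unitarymx -> normc (A i j) <= 1.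
Proof.
move=> /unitarymxP uA; have := @row_norm_le1 _ (row i A) j; rewrite mxE; apply.
have /matrixP/(_ i i) := uA; rewrite !mxE eqxx => Ai.
by apply/matrixP => a b; rewrite !ord1 !mxE -[RHS]Ai; apply: eq_bigr => k _; rewrite !mxE.
Qed.

Lemma l1_unitary n (A : 'M[C]_n) : A \is unitarymx -> l1 A <= (n * n)%:R.
Proof.
move=> uA; apply: (@le_trans _ _ (\sum_(i < n) \sum_(j < n) 1)).
  by do 2!apply: ler_sum => ? _; exact: unitary_entry.
by rewrite sumr_const sumr_const card_ord -mulrnA.
Qed.

Lemma l1_unitary_mull m n (A : 'M[C]_m) (B : 'M[C]_(m, n)) :
  A \is unitarymx -> l1 (A *m B) <= (m * m)%:R * l1 B.
Proof.
move=> uA; apply: le_trans (l1M _ _) _.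
by rewrite ler_wpM2r ?l1_ge0// l1_unitary.
Qed.

Lemma l1_unitary_mulr m n (A : 'M[C]_n) (B : 'M[C]_(m, n)) :
  A \is unitarymx -> l1 (B *m A) <= (n * n)%:R * l1 B.
Proof.
move=> uA; apply: le_trans (l1M _ _) _.
by rewrite mulrC ler_wpM2r ?l1_ge0// l1_unitary.
Qed.

Lemma l1_diag_le n (D : 'rV[C]_n) (e : R) :
  (forall i, normc (D 0 i) <= e) -> l1 (diag_mx D) <= n%:R * e.
Proof.
move=> De; apply: (@le_trans _ _ (\sum_(i < n) e)); last first.
  by rewrite sumr_const card_ord mulr_natl.
apply: ler_sum => i _; rewrite (bigD1 i)//= big1 ?addr0 ?mxE ?eqxx ?mulr1n//.
by move=> j ji; rewrite mxE eq_sym (negPf ji) normc0.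
Qed.

Definition quad n (A : 'M[C]_n) (v : 'rV[C]_n) : C := (v *m A *m v^t*) 0 0.

Lemma quadB n (A B : 'M[C]_n) v : quad (A - B) v = quad A v - quad B v.
Proof. by rewrite /quad mulmxBr mulmxBl !mxE. Qed.

Lemma quad_le n (A : 'M[C]_n) (v : 'rV[C]_n) :
  v *m v^t* = 1%:M -> normc (quad A v) <= l1 A.
Proof.
move=> v1; rewrite /quad mxE; apply: le_trans (normc_sum _) _.
rewrite /l1 exchange_big/=; apply: ler_sum => j _; rewrite normcM mxE.
apply: (@le_trans _ _ (normc (\sum_i v 0 i * A i j) * 1)).
  by rewrite ler_wpM2l ?normc_ge0// !mxE normc_conj row_norm_le1.
rewrite mulr1; apply: le_trans (normc_sum _) _; apply: ler_sum => i _.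
by rewrite normcM ler_piMl ?normc_ge0// row_norm_le1.
Qed.

(* The numerical range of a normal matrix is the convex hull of its spectrum, so
   the largest gap between eigenvalues is the diameter of the numerical range;
   unlike eigenvalues, the latter visibly depends continuously on the matrix. *)
Definition spread (t : R) n (A : 'M[C]_n) := exists v w : 'rV[C]_n,
  [/\ v *m v^t* = 1%:M, w *m w^t* = 1%:M & t <= normc (quad A v - quad A w)].

Lemma spread_perturb t e n (A B : 'M[C]_n) :
  spread t A -> l1 (A - B) <= e -> spread (t - 2 * e) B.
Proof.
move=> [v [w [v1 w1 tvw]]] ABe; exists v, w; split => //.
have v2 := quad_le (A - B) v1; have w2 := quad_le (A - B) w1.
move: v2 w2; rewrite !quadB.
rewrite (_ : quad A v - quad A w = (quad A v - quad B v) - (quad A w - quad B w)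
  + (quad B v - quad B w)) in tvw; last by ring.
have := le_normcD ((quad A v - quad B v) - (quad A w - quad B w))
  (quad B v - quad B w).
have := le_normcD (quad A v - quad B v) (- (quad A w - quad B w)).
rewrite normcN; move: tvw; lra.
Qed.

Lemma unitary_spectral n (A : 'M[C]_n) : A \is unitarymx ->
  exists (u : 'M[C]_n) (D : 'rV[C]_n), [/\ u \is unitarymx,
    A = u^t* *m diag_mx D *m u & forall i, normc (D 0 i) = 1].
Proof.
move=> uA; exists (spectralmx A), (spectral_diag A).
have uS := spectral_unitarymx A; rewrite -invmx_unitary//.
have nA : A \is normalmx.
  by apply/normalmxP; rewrite (unitarymxPl uA) unitarymxPr.
have AE := orthomx_spectralP nA; split => // i.
have DE : diag_mx (spectral_diag A) = spectralmx A *m A *m (spectralmx A)^t*.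
  rewrite [X in _ = _ *m X *m _]AE !mulmxA mulmxV ?unitarymx_unit// mul1mx.
  by rewrite -mulmxA (unitarymxPl uS) mulmx1.
have : diag_mx (spectral_diag A) \is unitarymx.
  by rewrite DE !mul_unitarymx// trmxC_unitary.
move=> /unitarymxP/matrixP/(_ i i); rewrite !mxE eqxx (bigD1 i)//= big1 => [|k ki].
  by rewrite !mxE eqxx/= addr0 => ?; apply: unimodular_normc.
by rewrite !mxE eq_sym (negPf ki) mul0r.
Qed.

(** In the eigenbasis the values of [quad] at unit vectors are convex combinations of the
    eigenvalues, so a difference of two values is an average of differences of eigenvalues. *)
Lemma spread_spectral n t e (u : 'M[C]_n) (D : 'rV[C]_n) : u \is unitarymx ->
  spread t (u^t* *m diag_mx D *m u) -> 0 <= e ->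
  (forall i j, normc (D 0 i - D 0 j) <= e) -> t <= e.
Proof.
move=> uu [v [w [v1 w1 tvw]]] e0 De; apply: le_trans tvw _.
have qE x : x *m x^t* = 1%:M -> exists p : 'I_n -> R, [/\ forall i, 0 <= p i,
    \sum_i p i = 1 & quad (u^t* *m diag_mx D *m u) x = \sum_i (p i)%:C%C * D 0 i].
  move=> x1; pose y := x *m u^t*; have yE : y^t* = u *m x^t*.
    by rewrite /y trmx_mul map_mxM trmxCK.
  have y1 : y *m y^t* = 1%:M.
    by rewrite yE /y mulmxA -(mulmxA x) unitarymxPr// mulmx1.
  exists (fun i => normc (y 0 i) ^+ 2); split => [i||].
  - by rewrite exprn_ge0 ?normc_ge0.
  - apply: complexI; rewrite rmorph_sum/=.
    have /matrixP/(_ 0 0) := y1; rewrite !mxE eqxx mulr1n => y1'.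
    apply: (etrans _ y1').
    by apply: eq_bigr => i _; rewrite rmorphXn/= -norm_normc !mxE normCK.
  - rewrite /quad !mulmxA -/y -mulmxA -yE -mulmxA mxE; apply: eq_bigr => i _.
    rewrite mul_diag_mx !mxE rmorphXn/= -norm_normc normCK.
    by rewrite mulrCA mulrC -mulrA.
have [p [p0 p1 ->]] := qE _ v1; have [q [q0 q1 ->]] := qE _ w1.
have -> : \sum_i (p i)%:C%C * D 0 i - \sum_i (q i)%:C%C * D 0 i =
    \sum_i \sum_j (p i * q j)%:C%C * (D 0 i - D 0 j).
  under [RHS]eq_bigr => i _ do
    (under eq_bigr => j _ do rewrite mulrBr rmorphM/=; rewrite sumrB).
  rewrite sumrB; congr (_ - _).
    apply: eq_bigr => i _; rewrite -mulr_suml -mulr_sumr -rmorph_sum q1.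
    by rewrite mulr1.
  rewrite exchange_big/=; apply: eq_bigr => j _.
  by rewrite -mulr_suml -mulr_suml -rmorph_sum p1 mul1r.
apply: le_trans (normc_sum _) _.
apply: (@le_trans _ _ (\sum_i \sum_j p i * q j * e)).
  apply: ler_sum => i _; apply: le_trans (normc_sum _) _; apply: ler_sum => j _.
  rewrite normcM ler_pM ?normc_ge0// -lecR -norm_normc ger0_norm//.
  by rewrite ler0c mulr_ge0.
under eq_bigr => i _ do rewrite -mulr_suml -mulr_sumr q1 mulr1.
by rewrite -mulr_suml p1 mul1r.
Qed.

End entrywise_norm.

(** * Commutators in SU(n) *)

Section special_unitary_estimates.
Context {R : realType} {n : nat}.
Local Notation C := R[i].
Implicit Types x y s a : SU R n.

Lemma SU_val_in x : \val x \is unitarymx /\ \det (\val x) = 1.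
Proof. by have := set_valP x. Qed.

Lemma SU_unitary x : \val x \is unitarymx.
Proof. by have [] := SU_val_in x. Qed.

Lemma val_SUM x y : \val (x * y)%g = \val x *m \val y.
Proof. by []. Qed.

Lemma val_SU1 : \val (1%g : SU R n) = 1%:M.
Proof. by []. Qed.

Lemma val_SUV x : \val (x^-1)%g = (\val x)^t*.
Proof. by rewrite -invmx_unitary ?SU_unitary. Qed.

Definition mkSU (A : 'M[C]_n) (uA : A \is unitarymx) (dA : \det A = 1) : SU R n :=
  SigSub (mem_set (conj uA dA : SU_set A)).

Definition nm x : R := l1 (\val x - 1%:M).

Let N : R := (n * n)%:R.
Let N0 : 0 <= N. Proof. exact: ler0n. Qed.

Lemma nm_ge0 x : 0 <= nm x. Proof. exact: l1_ge0. Qed.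

Lemma nm_eq0 x : nm x <= 0 -> x = 1%g.
Proof. by move=> /l1_eq0/eqP; rewrite subr_eq0 => /eqP xE; apply: val_inj. Qed.

Lemma nm_le x : nm x <= N + N.
Proof.
by apply: le_trans (l1B _ _) _; rewrite lerD// l1_unitary// ?SU_unitary// (SU_unitary 1%g).
Qed.

Definition comm x y := (x * y * x^-1 * y^-1)%g.

Lemma comm1l y : comm 1%g y = 1%g.
Proof. by rewrite /comm invg1 mulg1 mul1g mulgV. Qed.

Lemma comm_eq1 x y : comm x y = 1%g -> \val x *m \val y = \val y *m \val x.
Proof.
move=> xy1; have xyE : (x * y)%g = (comm x y * (y * x))%g.
  by rewrite /comm !mulgA !mulgVK.
by rewrite -!val_SUM xyE xy1 mul1g.
Qed.

(** The identity [x y - y x = (x - 1)(y - 1) - (y - 1)(x - 1)] makes commutators quadratically close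
    to 1; each of the two unitary factors on the right costs an [N]. *)
Lemma nm_comm x y : nm (comm x y) <= 2 * N ^+ 2 * (nm x * nm y).
Proof.
have -> : nm (comm x y) = l1 (((\val x - 1%:M) *m (\val y - 1%:M) -
    (\val y - 1%:M) *m (\val x - 1%:M)) *m \val x^-1%g *m \val y^-1%g).
  have -> : (\val x - 1%:M) *m (\val y - 1%:M) - (\val y - 1%:M) *m (\val x - 1%:M)
      = \val x *m \val y - \val y *m \val x.
    rewrite !mulmxBl !mulmxBr !mul1mx !mulmx1.
    move: (\val x *m \val y) (\val y *m \val x) (\val x) (\val y) => P Q X Y.
    by apply/matrixP => i j; rewrite !mxE; ring.
  by rewrite /nm !mulmxBl -!val_SUM mulgK mulgV.
apply: le_trans (l1_unitary_mulr _ (SU_unitary _)) _.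
apply: le_trans (ler_wpM2l N0 (l1_unitary_mulr _ (SU_unitary _))) _.
rewrite -/N [leLHS]mulrA -expr2 (mulrC 2) -[leRHS]mulrA.
apply: ler_wpM2l; first by rewrite exprn_ge0.
apply: le_trans (l1B _ _) _; rewrite mulrDl !mul1r lerD//; first exact: l1M.
by rewrite mulrC l1M.
Qed.

(** The two occurrences of [x] are replaced by [y] one at a time, using
    [x^-1 - y^-1 = x^-1 (y - x) y^-1]. *)
Lemma comm_perturb s x y :
  l1 (\val (comm s x) - \val (comm s y)) <= (N ^+ 3 + N ^+ 5) * l1 (\val x - \val y).
Proof.
have -> : \val (comm s x) - \val (comm s y) = \val s *m
    ((\val x - \val y) *m \val s^-1%g *m \val x^-1%g +
     \val (y * s^-1 * x^-1)%g *m (\val y - \val x) *m \val y^-1%g).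
  rewrite mulmxBr !mulmxBl -!val_SUM.
  have -> : (y * s^-1 * x^-1 * y * y^-1 = y * s^-1 * x^-1)%g by rewrite mulgK.
  have -> : (y * s^-1 * x^-1 * x * y^-1 = y * s^-1 * y^-1)%g by rewrite mulgVK.
  rewrite addrA subrK mulmxBr -!val_SUM /comm !mulgA.
  by [].
apply: le_trans (l1_unitary_mull _ (SU_unitary _)) _.
rewrite exprS (exprS _ 4) -mulrDr -mulrA ler_wpM2l// mulrDl.
apply: le_trans (l1D _ _) _; apply: lerD.
  apply: le_trans (l1_unitary_mulr _ (SU_unitary _)) _.
  by rewrite expr2 -mulrA ler_wpM2l// l1_unitary_mulr// SU_unitary.
apply: (@le_trans _ _ (N ^+ 2 * l1 (\val x - \val y))).
  apply: le_trans (l1_unitary_mulr _ (SU_unitary _)) _.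
  by rewrite expr2 -mulrA ler_wpM2l// (l1_distC (\val x)) l1_unitary_mull// SU_unitary.
(* [N] is a natural number, so [N ^+ 2 <= N ^+ 4] also when it is 0. *)
rewrite ler_wpM2r ?l1_ge0// /N -!natrX ler_nat.
by case: (n * n)%N => // k; rewrite leq_pexp2l.
Qed.


Let vec i (u : 'M[C]_n) : 'rV[C]_n := delta_mx 0 i *m u.

Let vec_unit i u : u \is unitarymx -> vec i u *m (vec i u)^t* = 1%:M.
Proof.
move=> uu; rewrite /vec trmx_mul map_mxM mulmxA -(mulmxA _ u) (unitarymxPl uu) mulmx1.
rewrite trmx_delta map_delta_mx mul_delta_mx.
by apply/matrixP => j k; rewrite !ord1 !mxE !eqxx.
Qed.

Let quad_vec i u (e : 'rV[C]_n) : u \is unitarymx ->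
  quad (u^t* *m diag_mx e *m u) (vec i u) = e 0 i.
Proof.
move=> uu; rewrite /quad /vec trmx_mul map_mxM !mulmxA.
rewrite -(mulmxA _ u (u^t*)) (unitarymxPl uu) mulmx1.
rewrite -(mulmxA _ u (u^t*)) (unitarymxPl uu) mulmx1.
rewrite trmx_delta map_delta_mx -rowE mxE (bigD1 i)//= big1 => [|k ki].
  by rewrite !mxE !eqxx mulr1n mulr1 addr0.
by rewrite !mxE !(negPf ki) mulr0.
Qed.

Lemma normc_det (A : 'M[C]_n) : A \is unitarymx -> normc (\det A) = 1.
Proof.
move=> uA; apply: unimodular_normc.
have <- : \det (A^t*) = (\det A)^* by rewrite det_map_mx det_tr.
by rewrite -det_mulmx (unitarymxPl uA) det1.
Qed.

(** Scale by an nth root of the inverse determinant. Commutators do not see the scalar, so they can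
    be built from unitary matrices of any determinant. *)
Lemma scale_to_SU (A : 'M[C]_n) : (0 < n)%N -> A \is unitarymx ->
  exists (a : SU R n) (c : C), c * c^* = 1 /\ \val a = c *: A.
Proof.
move=> n0 uA; pose c : C := n.-root (\det A)^-1.
have cn : c ^+ n = (\det A)^-1 by exact: rootCK.
have c1 : c * c^* = 1.
  rewrite -normCK; suff -> : `|c| = 1 by rewrite expr1n.
  apply: (@pexpIrn _ n) => //; rewrite ?nnegrE//.
  by rewrite -normrX cn expr1n norm_normc normcV normc_det// invr1.
have uc : c *: A \is unitarymx.
  apply/unitarymxP; rewrite linearZ/= map_mxZ -scalemxAl -scalemxAr scalerA c1 scale1r.
  exact: unitarymxPl.
have dc : \det (c *: A) = 1.
  rewrite detZ cn mulVf//; apply/eqP => d0; have := normc_det uA.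
  by rewrite d0 normc0 => /esym/eqP; rewrite oner_eq0.
by exists (mkSU uc dc), c.
Qed.

Lemma comm_scale s a (A : 'M[C]_n) (c : C) : c * c^* = 1 -> \val a = c *: A ->
  \val (comm s a) = \val s *m A *m (\val s)^t* *m A^t*.
Proof.
move=> c1 aE; rewrite /comm !val_SUM !val_SUV aE.
have -> : (c *: A)^t* = c^* *: A^t* by rewrite linearZ/= map_mxZ.
by rewrite -!(scalemxAr, scalemxAl) scalerA mulrC c1 scale1r.
Qed.

Lemma trmxC_mul (A B : 'M[C]_n) : (A *m B)^t* = B^t* *m A^t*.
Proof. by rewrite trmx_mul map_mxM. Qed.

Let conj_mul4 (K : comNzRingType) (u v A B D E : 'M[K]_n) : u *m v = 1%:M ->
  (v *m A *m u) *m (v *m B *m u) *m (v *m D *m u) *m (v *m E *m u)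
  = v *m (A *m B *m D *m E) *m u.
Proof.
move=> uv; have uK F : F *m u *m v = F by rewrite -mulmxA uv mulmx1.
by rewrite !mulmxA !uK.
Qed.

(* Conjugating by the transposition that exchanges two eigenvalues at distance at
   least 1/2 gives a commutator with eigenvalues [z], [z^-1] and (as n >= 3) 1. *)
Lemma spread_comm s : (2 < n)%N -> spread (11 / 20) (\val s) ->
  exists a, spread (3 / 5) (\val (comm s a)).
Proof.
move=> n3 ss; have [u [D [uu sE D1]]] := unitary_spectral (SU_unitary s).
(* By convexity of the numerical range, a spread above 1/2 forces two eigenvalues at least 1/2
   apart. *)
have [j [k jk]] : exists j k, 1 / 2 <= normc (D 0 j - D 0 k).
  apply: contrapT => /forallNP H; have : (11 / 20 : R) <= 1 / 2; last lra.
  rewrite sE in ss; apply: (spread_spectral uu ss); first by lra.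
  move=> i j; rewrite leNgt; apply/negP => ij; apply: (H i).
  by exists j; exact: ltW.
pose p := tperm j k.
have up : perm_mx p \is @unitarymx C n n.
  by apply/unitarymxP; rewrite tr_perm_mx map_perm_mx -perm_mxM mulgV perm_mx1.
have [||a [c [c1 aE]]] := @scale_to_SU (u^t* *m perm_mx p *m u).
- by case: (n) n3.
- apply: mul_unitarymx; last exact: uu.
  by apply: mul_unitarymx; [rewrite trmxC_unitary; exact: uu|exact: up].
(* The commutator with a permutation of the eigenbasis is again diagonal there, with these
   entries. *)
pose e : 'rV[C]_n := \row_i (D 0 i * (D 0 (p i))^*).
have cE : \val (comm s a) = u^t* *m diag_mx e *m u.
  have cT B : (u^t* *m B *m u)^t* = u^t* *m B^t* *m u.
    by rewrite trmxC_mul trmxC_mul trmxCK mulmxA.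
  rewrite (comm_scale _ c1 aE) sE cT cT (conj_mul4 _ _ _ _ (unitarymxPl uu)).
  congr (_ *m _ *m _).
  apply/matrixP => x y.
  rewrite -!mulmxA mul_diag_mx mxE -row_permE tr_perm_mx map_perm_mx -col_permE.
  rewrite !mxE (inj_eq perm_inj) [y == x]eq_sym.
  by case: eqP => [->|]; rewrite ?mulr1n ?mulr0n ?rmorph0 ?mulr0.
have qe (x : 'I_n) : quad (\val (comm s a)) (vec x u) = D 0 x * (D 0 (p x))^*.
  by rewrite cE (quad_vec _ _ uu) mxE.
have sp (x y : 'I_n) t : t <= normc (D 0 x * (D 0 (p x))^* - D 0 y * (D 0 (p y))^*) ->
    spread t (\val (comm s a)).
  move=> H; exists (vec x u), (vec y u).
  by rewrite (vec_unit x uu) (vec_unit y uu) !qe.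
have DD (x : 'I_n) : D 0 x * (D 0 x)^* = 1.
  by rewrite -normCK norm_normc D1 expr1n.
have njk : j != k.
  by apply/eqP => jkE; move: jk; rewrite jkE subrr normc0; lra.
have [l [lj lk]] : exists l, l != j /\ l != k.
  apply: contrapT => /forallNP H.
  have : (#|[set: 'I_n]%SET| <= #|[set j; k]%SET|)%N.
    apply/subset_leq_card/fintype.subsetP => l _; rewrite !inE.
    by apply/norP => -[lj lk]; apply: (H l).
  by rewrite cardsT card_ord cards2 njk leqNgt n3.
exists a; pose z := D 0 j * (D 0 k)^*.
have z1 : normc (z - 1) = normc (D 0 j - D 0 k).
  by rewrite /z -(DD k) -mulrBl normcM normc_conj D1 mulr1.
(* If [z] is far from 1, it is compared with the eigenvalue 1 at the third index [l]. *)
have [big|small] := leP (3 / 5) (normc (z - 1)).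
  apply: (sp j l); rewrite /p tpermL tpermD 1?eq_sym// DD.
  by rewrite -/z.
(* Otherwise [z] is compared with its conjugate. If [x] is the distance from [z] to 1, which is
   between 1/2 and 3/5, the two are at least [x (2 - x)] apart, which exceeds 3/5. *)
apply: (sp j k); rewrite /p tpermL tpermR -/z.
have -> : D 0 k * (D 0 j)^* = z^* by rewrite /z rmorphM/= conjCK mulrC.
have zz : z * z^* = 1.
  rewrite /z rmorphM/= conjCK.
  have -> : D 0 j * (D 0 k)^* * ((D 0 j)^* * D 0 k) =
    (D 0 j * (D 0 j)^*) * (D 0 k * (D 0 k)^*) by ring.
  by rewrite !DD mulr1.
have zn : normc z = 1 by exact: unimodular_normc.
have -> : z - z^* = (z - 1) * (z + 1) * z^*.
  have -> : (z - 1) * (z + 1) * z^* = z * (z * z^*) - z^* by ring.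
  by rewrite zz mulr1.
rewrite !normcM normc_conj zn mulr1.
have : 2 - normc (z - 1) <= normc (z + 1).
  have := le_normcD (z + 1) (- (z - 1)); rewrite normcN.
  have -> : z + 1 - (z - 1) = 2 by ring.
  have -> : normc (2 : C) = 2.
    by apply: complexI; rewrite -norm_normc normr_nat rmorph_nat.
  lra.
move: small jk; rewrite -z1; set x := normc (z - 1); set y := normc (z + 1).
nra.
Qed.

End special_unitary_estimates.

(** * Small and nonscalar elements of SU(n) *)

Section special_unitary_elements.
Context {R : realType} {n : nat}.
Local Notation C := R[i].
Implicit Types x y f a h : SU R n.

Let N : R := (n * n)%:R.
Let N0 : 0 <= N. Proof. exact: ler0n. Qed.

Definition nonscalar (A : 'M[C]_n) := forall c, A <> c%:M.

Lemma spread_nonscalar t (A : 'M[C]_n) : 0 < t -> spread t A -> nonscalar A.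
Proof.
move=> t0 [v [w [v1 w1 tvw]]] c AE; move: tvw; rewrite AE.
have q u : u *m u^t* = 1%:M -> quad (c%:M : 'M[C]_n) u = c.
  move=> u1; rewrite /quad mul_mx_scalar -scalemxAl u1.
  by rewrite !mxE eqxx mulr1n mulr1.
by rewrite (q _ v1) (q _ w1) subrr normc0; lra.
Qed.

Lemma normc_nat m : normc (m%:R : C) = m%:R.
Proof. by apply: complexI; rewrite -norm_normc normr_nat rmorph_nat. Qed.

(** A scalar [c] in SU(n) is an nth root of unity. Unless [c = 1], its first [n] powers sum to 0,
    whereas for [c] close to 1 their sum is close to [n]. *)
Lemma small_nonscalar x : (0 < n)%N -> x <> 1%g -> n%:R * nm x < 1 ->
  nonscalar (\val x).
Proof.
move=> n0 x1 nx c xE; apply: x1; apply: val_inj; rewrite val_SU1 xE.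
pose i0 : 'I_n := Ordinal n0.
have cx : normc (c - 1) <= nm x.
  rewrite (_ : c - 1 = (\val x - 1%:M) i0 i0) ?l1_entry//.
  by rewrite xE !mxE eqxx !mulr1n.
have cn : c ^+ n = 1.
  by have [_] := SU_val_in x; rewrite xE det_scalar.
have c1 : normc c = 1.
  have : (\val x *m (\val x)^t*) i0 i0 = 1.
    by rewrite (unitarymxPl (SU_unitary x)) mxE eqxx.
  rewrite xE mul_scalar_mx !mxE eqxx !mulr1n; exact: unimodular_normc.
have cX k : normc (c ^+ k) = 1.
  by elim: k => [|k IH]; rewrite ?expr0 ?normc1// exprS normcM c1 IH mulr1.
have c1k k : normc (c ^+ k - 1) <= k%:R * normc (c - 1).
  elim: k => [|k IH]; first by rewrite expr0 subrr normc0 mul0r.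
  have -> : c ^+ k.+1 - 1 = c ^+ k * (c - 1) + (c ^+ k - 1) by rewrite exprS; ring.
  apply: le_trans (le_normcD _ _) _; rewrite normcM cX mul1r -natr1 mulrDl mul1r.
  by rewrite addrC lerD2r.
congr (_%:M); apply/eqP; rewrite -subr_eq0; apply/negPn/negP => nc1.
have := subrX1 c n; rewrite cn subrr => /esym/eqP; rewrite mulf_eq0 (negPf nc1)/= => /eqP s0.
have : normc (\sum_(i < n) (c ^+ i - 1)) <= n%:R * (n%:R * normc (c - 1)).
  apply: le_trans (normc_sum _) _.
  apply: (@le_trans _ _ (\sum_(i < n) n%:R * normc (c - 1))).
    apply: ler_sum => i _; apply: le_trans (c1k _) _.
    by rewrite ler_wpM2r ?normc_ge0// ler_nat ltnW.
  by rewrite sumr_const card_ord -[leLHS]mulr_natl.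
rewrite sumrB s0 sub0r normcN sumr_const card_ord normc_nat.
have n0' : 0 < n%:R :> R by rewrite ltr0n.
have : n%:R * normc (c - 1) <= n%:R * nm x by rewrite ler_pM2l.
by move: nx n0'; move: (n%:R : R) (nm x) (normc (c - 1)) => a b d; nra.
Qed.

(** For a power [y] of [x], [2 (y - 1) = (y^2 - 1) - (y - 1)^2]. As all powers are within 1/2 of 1,
    any bound valid for all of them improves by the factor 3/4. *)
Lemma no_small_cyclic_subgroup x : (forall m, nm (x ^+ m)%g <= 1 / 2) -> x = 1%g.
Proof.
move=> xm; have H k : forall m, nm (x ^+ m)%g <= 1 / 2 * (3 / 4) ^+ k.
  elim: k => [|k IH] m; first by rewrite expr0 mulr1.
  set y := (x ^+ m)%g; have y2 : nm (y * y)%g <= 1 / 2 * (3 / 4) ^+ k.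
    by rewrite /y -expgnDr.
  have y1 : nm y <= 1 / 2 * (3 / 4) ^+ k by exact: IH.
  have q1 : (3 / 4) ^+ k <= 1 :> R by rewrite exprn_ile1//; lra.
  have q0 : 0 <= (3 / 4) ^+ k :> R by rewrite exprn_ge0//; lra.
  have yE : (\val y - 1%:M) *+ 2 = (\val (y * y)%g - 1%:M) -
      (\val y - 1%:M) *m (\val y - 1%:M).
    rewrite val_SUM mulmxBl !mulmxBr mulmx1 !mul1mx.
    move: (\val y *m \val y) (\val y) => P Q.
    by apply/matrixP => i j; rewrite mulr2n !mxE; ring.
  have n2 : l1 ((\val y - 1%:M) *+ 2) = 2 * nm y.
    rewrite /l1 /nm /l1 mulr_sumr; apply: eq_bigr => i _; rewrite mulr_sumr.
    by apply: eq_bigr => j _; rewrite mulr2n mxE -mulr2n normcMn mulr_natl.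
  have : 2 * nm y <= nm (y * y)%g + nm y * nm y.
    by rewrite -n2 yE; apply: le_trans (l1B _ _) _; rewrite lerD2l l1M.
  have := nm_ge0 y; move: y1 y2; rewrite exprS.
  by move: (nm y) (nm (y * y)%g) ((3 / 4) ^+ k) q0 q1 => a b q; nra.
apply: nm_eq0; rewrite leNgt; apply/negP => x0.
have [k _ /(_ k (leqnn k)) /= kE] := near_infty_natSinv_expn_lt (PosNum x0).
have := H (3 * k)%N 1%N; rewrite expg1.
(* Three improvements gain a factor 27/64, which is below 1/2. *)
have : (3 / 4) ^+ (3 * k)%N <= 2^-1 ^+ k :> R.
  rewrite exprM; apply: lerXn2r; rewrite ?nnegrE ?exprn_ge0//; lra.
have : 0 <= 2^-1 ^+ k :> R by rewrite exprn_ge0// invr_ge0.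
by move: kE; rewrite div1r -exprVn; lra.
Qed.

(** The quotient of [1 + i t] by its conjugate gives such numbers without trigonometric
    functions. *)
Lemma unimodular_near1 (e : R) : 0 < e -> exists w : C,
  [/\ w * w^* = 1, w <> w^* & normc (w - 1) <= e].
Proof.
move=> e0; pose t := Num.min (e / 2) (1 / 2).
have t0 : 0 < t by rewrite lt_min; apply/andP; split; lra.
have te : t <= e / 2 by rewrite ge_min lexx.
have t1 : t <= 1 / 2 by rewrite ge_min lexx orbT.
pose z : C := (1 +i* t)%C; have zc : z^* = (1 -i* t)%C by [].
have z1 : 1 <= normc z.
  by rewrite /= expr1n -[leLHS]sqrtr1 ler_wsqrtr// lerDl sqr_ge0.
have zn0 : normc z != 0 by rewrite gt_eqF// (lt_le_trans ltr01 z1).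
have z0 : z != 0 by apply: contra zn0 => /eqP ->; rewrite normc0.
have zc0 : z^* != 0 by rewrite conjC_eq0.
have wc : (z / z^*)^* = z^* / z by rewrite rmorphM fmorphV/= conjCK.
exists (z / z^*); rewrite wc; split.
- by rewrite mulrA (divfK zc0) (mulfV z0).
- move=> /eqP; rewrite eqr_div// zc /z.
  by rewrite eq_complex/= => /andP[_ /eqP]; nra.
- have -> : z / z^* - 1 = (z - z^*) / z^* by rewrite mulrBl mulfV.
  rewrite normcM normcV normc_conj.
  have -> : z - z^* = (0 +i* (t + t))%C.
    by rewrite zc /z; apply/eqP; rewrite eq_complex/= subrr opprK !eqxx.
  have -> : normc (0 +i* (t + t))%C = t + t.
    by rewrite /= expr0n/= add0r sqrtr_sqr ger0_norm//; lra.
  rewrite ler_pdivrMr; last by lra.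
  by rewrite (@le_trans _ _ (e * 1))//; [lra|rewrite ler_pM2l].
Qed.

(** Conjugate the diagonal matrix with [w] and its conjugate at [j] and [k] by the reflection [r] in
    the rational unit vector (3/5, 4/5). The entries of [r] in this plane are 7/25, -24/25 and
    -7/25, whence 168/625. *)
Lemma plane_rotation (j k : 'I_n) (w : C) : j != k -> w * w^* = 1 ->
  exists A : 'M[C]_n, [/\ A \is unitarymx, \det A = 1,
    l1 (A - 1%:M) <= N ^+ 2 * (n%:R * normc (w - 1)) &
    normc (A j k) = 168 / 625 * normc (w - w^*)].
Proof.
move=> jk ww.
pose v : 'rV[C]_n := \row_i (if i == j then 3 / 5 else if i == k then 4 / 5 else 0).
pose r : 'M[C]_n := 1%:M - 2 *: (v^T *m v).
have [D DE] : exists D : 'rV[C]_n, forall i,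
    D 0 i = if i == j then w else if i == k then w^* else 1.
  by exists (\row_i (if i == j then w else if i == k then w^* else 1)) => i; rewrite mxE.
have vj : v 0 j = 3 / 5 by rewrite mxE eqxx.
have vk : v 0 k = 4 / 5 by rewrite mxE eq_sym (negPf jk) eqxx.
have vi i : i != j -> i != k -> v 0 i = 0 by move=> ij ik; rewrite mxE (negPf ij) (negPf ik).
have big2 (F : 'I_n -> C) : (forall i, i != j -> i != k -> F i = 0) ->
    \sum_i F i = F j + F k.
  move=> F0; rewrite (bigD1 j)//= (bigD1 k) 1?eq_sym//= big1 ?addr0//.
  by move=> i /andP[]; exact: F0.
have vv : v *m v^T = 1%:M.
  apply/matrixP => p q; rewrite !ord1 !mxE eqxx mulr1n big2; last first.
    by move=> i ij ik; rewrite vi// mul0r.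
  by rewrite !mxE eqxx eq_sym (negPf jk) eqxx; field.
have rE (p q : 'I_n) : r p q = (p == q)%:R - 2 * (v 0 p * v 0 q).
  by rewrite !mxE big_ord1 !mxE.
have rr : r *m r = 1%:M.
  rewrite /r mulmxBl mul1mx mulmxBr mulmx1 -scalemxAl -scalemxAr mulmxA -(mulmxA _ v) vv.
  rewrite mulmx1 scalerA; move: (v^T *m v) => V.
  by apply/matrixP => p q; rewrite !mxE; ring.
have rH : r^t* = r.
  have vR i : v 0 i \is Num.real.
    by rewrite mxE; case: ifP => _; [|case: ifP => _]; rewrite ?rpred0// rpred_div// rpred_nat.
  apply/matrixP => p q; rewrite mxE mxE conj_Creal; last first.
    by rewrite rE rpredB ?rpred_nat// rpredM ?rpred_nat// rpredM.
  by rewrite !rE eq_sym (mulrC (v 0 q)).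
have ur : r \is unitarymx by apply/unitarymxP; rewrite rH.
have DD i : D 0 i * (D 0 i)^* = 1.
  by rewrite DE; case: ifP => _; [|case: ifP => _]; rewrite ?conjCK// ?rmorph1 ?mulr1// mulrC.
have uD : diag_mx D \is unitarymx.
  apply/unitarymxP; rewrite mul_diag_mx; apply/matrixP => p q; rewrite !mxE eq_sym.
  have [->|_] := eqVneq p q; first by rewrite !mulr1n DD.
  by rewrite !mulr0n rmorph0 mulr0.
exists (r *m diag_mx D *m r); split.
- exact: (mul_unitarymx (mul_unitarymx ur uD) ur).
- rewrite det_mulmx det_mulmx mulrC mulrA -det_mulmx rr det1 mul1r det_diag.
  rewrite (bigD1 j)//= (bigD1 k) 1?eq_sym//= big1 => [|i /andP[ij ik]].
    by rewrite !DE eqxx eq_sym (negPf jk) eqxx mulr1.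
  by rewrite DE (negPf ij) (negPf ik).
- have -> : r *m diag_mx D *m r - 1%:M = r *m (diag_mx (D - const_mx 1)) *m r.
    have -> : diag_mx (D - const_mx 1) = diag_mx D - 1%:M.
      by apply/matrixP => p q; rewrite !mxE mulrnBl.
    by rewrite (mulmxBr r) (mulmxBl _ _ r) (mulmx1 r) rr.
  apply: le_trans (l1_unitary_mulr _ ur) _; rewrite -/N expr2 -mulrA ler_wpM2l//.
  apply: le_trans (l1_unitary_mull _ ur) _; rewrite -/N ler_wpM2l//.
  apply: l1_diag_le => i; rewrite !mxE DE; case: ifP => _; first by [].
  case: ifP => _; last by rewrite subrr normc0 normc_ge0.
  by rewrite (_ : w^* - 1 = (w - 1)^*) ?normc_conj// rmorphB rmorph1.
- rewrite mxE big2 => [|i ij ik]; last first.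
    by rewrite rE (vi _ ij ik) (negPf ik) !mul0r mulr0 subrr mulr0.
  rewrite mul_mx_diag ![(\matrix_(_, _) _) _ _]mxE !rE !DE vj vk !eqxx (negPf jk) eq_sym (negPf jk).
  set e := (X in normc X); have -> : e = (168 / 625) * (w^* - w).
    by rewrite /e /=; field.
  rewrite normcM normc_distC; congr (_ * _).
  by rewrite normcM normcV !normc_nat.
Qed.


(* With [f = u^* diag(D) u] and the entries [j], [k] of [D] at maximal distance,
   the witness [a] rotates the (j, k) plane of the eigenbasis by a small angle, so
   that the size of [f a - a f] is comparable to that of [f - D_j]. *)
Lemma commutant_scalar (rho : R) : 0 < rho -> exists2 eta : R, 0 < eta &
  forall f, nonscalar (\val f) -> exists a, forall h,
    l1 (\val h - \val a) <= eta -> nm h <= rho /\ comm f h <> 1%g.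
Proof.
move=> rho0; have [n0|n0] := posnP n.
  exists 1 => // f nf; exfalso; apply: (nf 0); apply/matrixP => i.
  by have := ltn_ord i; rewrite {2}n0.
have N1 : 1 <= N by rewrite /N ler1n muln_gt0 n0.
have n1 : 1 <= n%:R :> R by rewrite ler1n.
have [K KE] : exists K, N ^+ 4 * n%:R = K by eexists.
have K0 : 0 < K by rewrite -KE mulr_gt0 ?exprn_gt0// (lt_le_trans ltr01).
have [w [ww wn wr]] := @unimodular_near1 (rho / 2 / K) (divr_gt0 (divr_gt0 rho0 (ltr0Sn _ 1)) K0).
pose kap := 168 / 625 * normc (w - w^*).
have kap0 : 0 < kap.
  apply: mulr_gt0; first by apply: divr_gt0; rewrite ltr0n.
  rewrite lt_neqAle normc_ge0 andbT eq_sym.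
  by apply/eqP => /eq0_normc/eqP; rewrite subr_eq0 => /eqP.
(* The bound [rho / 2] keeps [h] within [rho] of 1, as [a] is within [rho / 2]; the bound
   [kap / 4 / K] makes the error term at most half of the main term. *)
exists (Num.min (rho / 2) (kap / 4 / K)).
  by rewrite lt_min !divr_gt0.
move=> f nf; have [u [D [uu fE D1]]] := unitary_spectral (SU_unitary f).
pose i0 : 'I_n := Ordinal n0.
pose gap (p : 'I_n * 'I_n) := normc (D 0 p.1 - D 0 p.2).
(* Maximality bounds the norm of [f - D_j] by a multiple of the gap. *)
have [p _ pmax] := @Order.TotalTheory.arg_maxP _ _ _ (i0, i0) predT gap isT.
case: p pmax => j k pmax.
have {}pmax i l : normc (D 0 i - D 0 l) <= gap (j, k) by exact: (pmax (i, l)).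
have s0 : 0 < gap (j, k).
  rewrite lt_neqAle normc_ge0 andbT eq_sym; apply/eqP => g0.
  have DE i : D 0 i = D 0 i0.
    apply/eqP; rewrite -subr_eq0; apply/eqP/eq0_normc/eqP.
    by rewrite eq_le normc_ge0 andbT -[leRHS]g0 pmax.
  apply: (nf (D 0 i0)); rewrite fE.
  have -> : diag_mx D = (D 0 i0)%:M.
    by apply/matrixP => i l; rewrite !mxE DE.
  by rewrite mul_mx_scalar -scalemxAl (unitarymxPr uu) scalemx1.
have jk : j != k by apply/eqP => jkE; move: s0; rewrite /gap /= jkE subrr normc0 ltxx.
have [A [uA dA A1 Ajk]] := plane_rotation jk ww.
have uV : u^t* \is unitarymx by rewrite trmxC_unitary; exact: uu.
have ua : u^t* *m A *m u \is unitarymx by exact: (mul_unitarymx (mul_unitarymx uV uA) uu).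
have da : \det (u^t* *m A *m u) = 1.
  by rewrite det_mulmx det_mulmx dA mulr1 -det_mulmx (unitarymxPr uu) det1.
pose a := mkSU ua da; have aE : \val a = u^t* *m A *m u by [].
have a1 : nm a <= rho / 2.
  have -> : nm a = l1 (u^t* *m (A - 1%:M) *m u).
    by rewrite /nm aE (mulmxBr (u^t*)) (mulmxBl _ _ u) mulmx1 (unitarymxPr uu).
  apply: le_trans (l1_unitary_mulr _ uu) _.
  apply: le_trans (ler_wpM2l N0 (l1_unitary_mull _ uV)) _; rewrite -/N.
  apply: (@le_trans _ _ (K * normc (w - 1))).
    have -> : K * normc (w - 1) = N ^+ 2 * (N ^+ 2 * (n%:R * normc (w - 1))).
      by rewrite -KE; ring.
    rewrite [leLHS]mulrA -expr2 ler_wpM2l ?exprn_ge0//.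
  by rewrite mulrC -ler_pdivlMr.
exists a => h; rewrite le_min => /andP[h1 h2]; split.
  have -> : nm h = l1 ((\val h - \val a) + (\val a - 1%:M)) by rewrite addrA subrK.
  by apply: le_trans (l1D _ _) _; rewrite [rho]splitr lerD.
move=> /comm_eq1 fh.
(* Since [h] commutes with [f], [F G - G F = a F - F a]. In the eigenbasis the right side has size
   at least [kap] times the gap, while the smallness of [G] allows only half of that. *)
pose F := \val f - (D 0 j)%:M; pose G := \val h - \val a.
have [Dl DlE] : exists X, X = diag_mx D - (D 0 j)%:M by eexists.
have FE : F = u^t* *m Dl *m u.
  rewrite /F DlE (mulmxBr (u^t*)) (mulmxBl _ _ u) -fE; congr (_ - _).
  by rewrite mul_mx_scalar -scalemxAl (unitarymxPr uu) scalemx1.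
have lF : l1 F <= N ^+ 2 * (n%:R * gap (j, k)).
  rewrite FE; apply: le_trans (l1_unitary_mulr _ uu) _.
  apply: le_trans (ler_wpM2l N0 (l1_unitary_mull _ uV)) _; rewrite -/N.
  rewrite [leLHS]mulrA -expr2 ler_wpM2l ?exprn_ge0//.
  have -> : Dl = diag_mx (D - const_mx (D 0 j)).
    by rewrite DlE; apply/matrixP => x y; rewrite !mxE mulrnBl.
  by apply: l1_diag_le => i; rewrite !mxE; exact: pmax.
have FG : F *m G - G *m F = u^t* *m (A *m Dl - Dl *m A) *m u.
  have uK B : B *m u *m u^t* = B by rewrite -mulmxA (unitarymxPl uu) mulmx1.
  have -> : F *m G - G *m F = \val a *m F - F *m \val a.
    have Fh : F *m \val h = \val h *m F.
      by rewrite /F mulmxBl mulmxBr fh mul_scalar_mx mul_mx_scalar.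
    rewrite /G (mulmxBr F) (mulmxBl _ _ F) Fh.
    by move: (_ *m F) (F *m \val a) (\val a *m F) => X Y Z; rewrite opprB addrC subrKA.
  rewrite aE FE !mulmxA !uK (mulmxBr (u^t*)) (mulmxBl _ _ u) !mulmxA.
  by [].
have e1 : kap * gap (j, k) <= l1 (A *m Dl - Dl *m A).
  rewrite /kap -Ajk -normcM.
  have DlE' : Dl = diag_mx (D - const_mx (D 0 j)).
    by rewrite DlE; apply/matrixP => x y; rewrite !mxE mulrnBl.
  have E1 : (A *m Dl) j k = A j k * (D 0 k - D 0 j).
    by rewrite DlE' mul_mx_diag !mxE.
  have E2 : (Dl *m A) j k = (D 0 j - D 0 j) * A j k.
    by rewrite DlE' mul_diag_mx !mxE.
  have -> : A j k * (D 0 j - D 0 k) = - ((A *m Dl) j k - (Dl *m A) j k).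
    by rewrite E1 E2; ring.
  have E3 (X Y : 'M[C]_n) : (X - Y) j k = X j k - Y j k by rewrite !mxE.
  by rewrite normcN -E3 l1_entry.
have e2 : l1 (A *m Dl - Dl *m A) <= N ^+ 2 * (l1 F * l1 G + l1 G * l1 F).
  have -> : A *m Dl - Dl *m A = u *m (F *m G - G *m F) *m u^t*.
    have uK B : B *m u *m u^t* = B by rewrite -mulmxA (unitarymxPl uu) mulmx1.
    by rewrite FG !mulmxA uK (unitarymxPl uu) mul1mx.
  apply: le_trans (l1_unitary_mulr _ uV) _.
  apply: le_trans (ler_wpM2l N0 (l1_unitary_mull _ uu)) _; rewrite -/N.
  rewrite [leLHS]mulrA -expr2 ler_wpM2l ?exprn_ge0//.
  by apply: le_trans (l1B _ _) _; rewrite lerD// l1M.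
have e3 : N ^+ 2 * (l1 F * l1 G + l1 G * l1 F) <= K * gap (j, k) * (2 * (kap / 4 / K)).
  have -> : K * gap (j, k) * (2 * (kap / 4 / K)) =
      N ^+ 2 * ((N ^+ 2 * (n%:R * gap (j, k))) * (kap / 4 / K) +
       (kap / 4 / K) * (N ^+ 2 * (n%:R * gap (j, k)))).
    by rewrite -{1}KE; ring.
  have h2' : l1 G <= kap / 4 / K by exact: h2.
  by rewrite ler_wpM2l ?exprn_ge0// lerD// ler_pM ?l1_ge0.
have : K * gap (j, k) * (2 * (kap / 4 / K)) = kap * gap (j, k) / 2.
  by field; rewrite gt_eqF.
have : 0 < kap * gap (j, k) by rewrite mulr_gt0.
by move: e1 e2 e3; lra.
Qed.

End special_unitary_elements.

(** * Kernels of projections to finitely many factors *)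

Lemma nbhs_nm (R : realType) (n : nat) (e : R) : 0 < e ->
  nbhs (1%g : SU R n) [set s : SU R n | nm s < e].
Proof.
move=> e0; pose N : R := (n * n)%:R; have N0 : 0 <= N by exact: ler0n.
(* The added 1 covers [n = 0] and makes the final estimate strict. *)
pose f := e / (N + 1); have f0 : 0 < f by rewrite divr_gt0// ltr_wpDl.
have fc0 : 0 < f%:C%C by rewrite ltcR.
apply: (@initial_continuous _ _ (set_val : SU R n -> 'M[R[i]]_n) 1%g
  [set B | l1 (B - 1%:M) < e]).
exists (fun i j => ball ((1%:M : 'M[R[i]]_n) i j) f%:C%C).
  by move=> i j; exact: nbhsx_ballx.
move=> B HB /=; apply: (@le_lt_trans _ _ (N * f)).
  have -> : N * f = \sum_(i < n) \sum_(j < n) f.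
    by rewrite sumr_const sumr_const card_ord -mulrnA mulr_natl.
  apply: ler_sum => i _; apply: ler_sum => j _.
  have : `|(1%:M : 'M[R[i]]_n) i j - B i j| < f%:C%C by exact: HB.
  by rewrite distrC norm_normc ltcR => /ltW; rewrite !mxE.
rewrite /f mulrCA -[ltRHS]mulr1 ltr_pM2l// ltr_pdivrMr; last by rewrite ltr_wpDl.
by rewrite mul1r ltrDl.
Qed.

(** * The metric of the product *)

Section prodSU_metric.
Context {R : realType} {d : forall n, biinvariant_metric R (SU R n.+1)}.
Implicit Types (x y z w h : prodSU d) (H : set (prodSU d)).

Let term x y : R^nat := fun n => 2^-1 ^+ n.+1 * d n (x n) (y n).

Let term_ge0 x y n : 0 <= term x y n.
Proof.
rewrite mulr_ge0 ?exprn_ge0 ?invr_ge0//.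
have := bidist_triangle (d n) (y n) (x n) (x n).
by rewrite bidistxx (bidist_sym _ (y n) (x n)) -mulr2n pmulrn_lge0.
Qed.

Let term_le x y n : term x y n <= 2^-1 ^+ n.+1.
Proof. by rewrite /term ler_piMr ?bidist_le1// exprn_ge0 ?invr_ge0. Qed.

Let half_sum n : \sum_(0 <= i < n) 2^-1 ^+ i.+1 = 1 - 2^-1 ^+ n :> R.
Proof.
elim: n => [|n IH]; first by rewrite big_geq// expr0 subrr.
by rewrite big_nat_recr//= IH exprS; lra.
Qed.

Let is_cvg_term x y : cvgn (series (term x y)).
Proof.
apply: nondecreasing_is_cvgn; last first.
  exists 1 => _ [n _ <-]; rewrite /series/=.
  apply: (@le_trans _ _ (\sum_(0 <= i < n) 2^-1 ^+ i.+1)).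
    by apply: ler_sum => i _; exact: term_le.
  by rewrite half_sum gerBl exprn_ge0// invr_ge0.
by apply/nondecreasing_seqP => k; rewrite seriesSr lerDl.
Qed.

Lemma mdist_coord x y n : 2^-1 ^+ n.+1 * d n (x n) (y n) <= mdist x y.
Proof.
apply: (@le_trans _ _ (series (term x y) n.+1)).
  by rewrite seriesSr lerDr; apply: sumr_ge0.
apply: nondecreasing_cvgn_le; last exact: is_cvg_term.
by apply/nondecreasing_seqP => k; rewrite seriesSr lerDl.
Qed.

Lemma mdist_tail x y N : (forall n, (n < N)%N -> x n = y n) ->
  mdist x y <= 2^-1 ^+ N.
Proof.
move=> xy; have h0 k : 0 <= 2^-1 ^+ k :> R by rewrite exprn_ge0// invr_ge0.
apply: limr_le; first exact: is_cvg_term.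
apply: nearW => n; rewrite /series/=.
have small m : (m <= N)%N -> \sum_(0 <= i < m) term x y i = 0.
  move=> mN; rewrite big_nat big1// => i /= im.
  by rewrite /term xy ?(leq_trans im)// bidistxx mulr0.
have [nN|Nn] := leqP n N; first by rewrite small.
rewrite (big_cat_nat (n := N))//= 1?ltnW// small// add0r.
apply: (@le_trans _ _ (\sum_(N <= i < n) 2^-1 ^+ i.+1)).
  by apply: ler_sum => i _; exact: term_le.
have := half_sum n; rewrite (big_cat_nat (n := N))//= 1?ltnW// half_sum.
by have := h0 n; lra.
Qed.

Lemma mdist_le_coord x y z w :
  (forall n, d n (x n) (y n) <= d n (z n) (w n)) -> mdist x y <= mdist z w.
Proof.
move=> xyzw; apply: ler_lim; [exact: is_cvg_term|exact: is_cvg_term|].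
apply: nearW => n; rewrite /series/=; apply: ler_sum => i _.
by rewrite ler_pM2l// exprn_gt0 ?invr_gt0.
Qed.

Lemma mdist_one_coord x y n : (forall i, i != n -> x i = y i) ->
  mdist x y <= d n (x n) (y n).
Proof.
move=> xy; apply: limr_le; first exact: is_cvg_term.
have d0 : 0 <= d n (x n) (y n).
  by have := term_ge0 x y n; rewrite pmulr_rge0// exprn_gt0 ?invr_gt0.
have h0 k : 0 <= 2^-1 ^+ k :> R by rewrite exprn_ge0// invr_ge0.
apply: nearW => m; rewrite /series/=.
apply: (@le_trans _ _ (\sum_(0 <= i < m) 2^-1 ^+ i.+1 * d n (x n) (y n))).
  apply: ler_sum => i _; have [->//|ni] := eqVneq i n.
  by rewrite /term xy// bidistxx mulr0 mulr_ge0.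
by rewrite -mulr_suml half_sum ler_piMl// gerBl.
Qed.

Lemma mdist_le1 x y : mdist x y <= 1.
Proof. by have := @mdist_tail x y 0%N; rewrite expr0; exact. Qed.

Lemma mdist_mull z x y : mdist (z * x)%g (z * y)%g = mdist x y.
Proof.
congr (limn (series _)); apply/funext => n; congr (_ * _).
exact: bidist_mull.
Qed.

Lemma mdist_mulr z x y : mdist (x * z)%g (y * z)%g = mdist x y.
Proof.
congr (limn (series _)); apply/funext => n; congr (_ * _).
exact: bidist_mulr.
Qed.

Lemma mdist_inv x y : mdist x^-1%g y^-1%g = mdist x y.
Proof.
by rewrite -(mdist_mull x) -(mdist_mulr y) mulgV mul1g mulgVK metric_sym.
Qed.

Lemma mdist_mul x y z w : mdist (x * y)%g (z * w)%g <= mdist x z + mdist y w.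
Proof.
by rewrite -(mdist_mull z y w) -(mdist_mulr y x z) metric_triangle.
Qed.

(** The metrics [d n] are arbitrary, so they are compared with the matrix norm through
    neighbourhoods of 1, and right invariance carries the comparison to all pairs. *)
Lemma l1_coord_continuous n (e : R) : 0 < e -> exists2 f : R, 0 < f &
  forall x y, mdist x y < f -> l1 (\val (x n) - \val (y n)) < e.
Proof.
move=> e0; pose N : R := (n.+1 * n.+1)%:R.
have N0 : 0 < N by rewrite ltr0n.
have /(bidist_nbhsE (d n))[f f0 fe] := nbhs_nm n.+1 (divr_gt0 e0 N0).
exists (2^-1 ^+ n.+1 * f) => [|x y xy]; first by rewrite mulr_gt0// exprn_gt0 ?invr_gt0.
have dxy : d n (x n) (y n) < f.
  have := le_lt_trans (mdist_coord x y n) xy.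
  by rewrite ltr_pM2l// exprn_gt0 ?invr_gt0.
have : nm (x n * (y n)^-1)%g < e / N.
  apply: fe => /=; rewrite bidist_sym -(bidist_mulr _ (y n)).
  by rewrite mul1g mulgVK.
rewrite ltr_pdivlMr// mulrC; apply: le_lt_trans.
have -> : \val (x n) - \val (y n) =
    (\val (x n * (y n)^-1)%g - 1%:M) *m \val (y n).
  by rewrite mulmxBl mul1mx -val_SUM mulgVK.
exact: l1_unitary_mulr (SU_unitary _).
Qed.

Lemma expg_coord x m n : (x ^+ m)%g n = (x n ^+ m)%g.
Proof. by elim: m => [//|m IH]; rewrite !expgS -IH. Qed.

Definition tail_subgroup M : set (prodSU d) := [set x | forall i, (i < M)%N -> x i = 1%g].

Lemma subgroup_tail M : subgroup (tail_subgroup M).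
Proof.
split=> [//|x y xM yM i iM|x xM i iM].
  by rewrite -[LHS]/(x i * y i)%g xM// yM// mulg1.
by rewrite -[LHS]/((x i)^-1)%g xM// invg1.
Qed.

Lemma closed_tail M : closed (tail_subgroup M).
Proof.
move=> x cx i iM; apply: nm_eq0; rewrite leNgt; apply/negP => e0.
have [f f0 fe] := l1_coord_continuous i e0.
have [|y [yM xy]] := cx [set y | mdist x y < f].
  by apply/nbhs_mdist; exists f.
by have := fe _ _ xy; rewrite (yM i iM) ltxx.
Qed.

Lemma subgroupI H H' : subgroup H -> subgroup H' -> subgroup (H `&` H').
Proof.
move=> [h1 hM hV] [k1 kM kV]; split=> [//|x y [? ?] [? ?]|x [? ?]].
  by split; [exact: hM|exact: kM].
by split; [exact: hV|exact: kV].
Qed.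

Definition prodSU_comm x y : prodSU d := (x * y * x^-1 * y^-1)%g.

Lemma prodSU_comm_coord x y n : prodSU_comm x y n = comm (x n) (y n).
Proof. by []. Qed.

Lemma subgroup_comm H x y : subgroup H -> H x -> H y -> H (prodSU_comm x y).
Proof.
move=> [_ HM HV] Hx Hy.
exact: (HM _ _ (HM _ _ (HM _ _ Hx Hy) (HV _ Hx)) (HV _ Hy)).
Qed.

End prodSU_metric.

(** The reflection diag(-1, 1, ..., 1), rescaled into SU(n), has two eigenvalues at distance 2. *)
Lemma exists_spread (R : realType) (n : nat) : (1 < n)%N ->
  exists a : SU R n, spread 2 (\val a).
Proof.
move=> n1; have n0 : (0 < n)%N by exact: ltnW.
pose i0 : 'I_n := Ordinal n0; pose i1 : 'I_n := Ordinal n1.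
have [D DE] : exists D : 'rV[R[i]]_n, forall i, D 0 i = if i == i0 then -1 else 1.
  by exists (\row_i (if i == i0 then -1 else 1)) => i; rewrite mxE.
have DD i : D 0 i * (D 0 i)^* = 1.
  by rewrite DE; case: ifP => _; rewrite ?rmorphN rmorph1 ?mulrNN mulr1.
have uD : diag_mx D \is unitarymx.
  apply/unitarymxP; rewrite mul_diag_mx; apply/matrixP => p q; rewrite !mxE eq_sym.
  have [->|_] := eqVneq p q; last by rewrite !mulr0n rmorph0 mulr0.
  by rewrite !mulr1n DD.
have [a [c [c1 aE]]] := scale_to_SU n0 uD.
exists a, (delta_mx 0 i0), (delta_mx 0 i1).
have e1 (i : 'I_n) : (delta_mx 0 i : 'rV[R[i]]_n) *m (delta_mx 0 i)^t* = 1%:M.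
  rewrite trmx_delta map_delta_mx mul_delta_mx.
  by apply/matrixP => j k; rewrite !ord1 !mxE !eqxx.
have q (i : 'I_n) : quad (\val a) (delta_mx 0 i) = c * D 0 i.
  rewrite /quad aE trmx_delta map_delta_mx -rowE -colE !mxE.
  by rewrite eqxx mulr1n.
split; [exact: e1|exact: e1|rewrite !q !DE eqxx].
have -> : (i1 == i0) = false by [].
have -> : c * -1 - c * 1 = - (2 * c) by ring.
by rewrite normcN normcM normc_nat (unimodular_normc c1) mulr1.
Qed.

(** * Nontrivial connected subgroups of the kernels *)

Section connected_kernel.
Context {R : realType} {d : forall n, biinvariant_metric R (SU R n.+1)}.
Variables (M n : nat).
Hypothesis n2 : (1 < n)%N.

Let N : R := (n.+1 * n.+1)%:R.
Let N1 : 1 <= N. Proof. by rewrite /N ler1n. Qed.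

(** This is what remains true of groups that are Hausdorff-close to one containing the whole factor
    of index [n]. *)
Definition nearly_contains (e : R) (H : set (prodSU d)) :=
  forall a : SU R n.+1, exists h, [/\ H h, forall i, (i < M)%N -> nm (h i) <= e &
    l1 (\val (h n) - \val a) <= e].

(** For [e] below [K1^-1], commutators with approximants halve the norms in the first [M]
    coordinates; below [K2^-1], approximating one argument of a commutator in coordinate [n] costs
    at most 1/40 in norm. *)
Let K1 : R := 2 * (2 * ((M * M)%:R ^+ 2) + 1).
Let K2 : R := 40 * (N ^+ 3 + N ^+ 5 + 1).

Let K1_gt0 : 0 < K1.
Proof. by rewrite mulr_gt0// ltr_wpDl// mulr_ge0// exprn_ge0. Qed.

Let K2_gt0 : 0 < K2.
Proof. by rewrite mulr_gt0// ltr_wpDl// addr_ge0// exprn_ge0 ?ler0n. Qed.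

Section subgroup.
Variables (H : set (prodSU d)) (e : R).
Hypotheses (gH : subgroup H) (cH : compact H) (eH : nearly_contains e H).
Hypotheses (eK1 : e <= K1^-1) (eK2 : e <= K2^-1).

Let e_ge0 : 0 <= e.
Proof.
by have [h [_ _]] := eH 1%g; apply: le_trans; exact: l1_ge0.
Qed.

Let contract w (t : R) : 0 <= t -> H w -> (forall i, (i < M)%N -> nm (w i) <= t) ->
  spread (11 / 20) (\val (w n)) -> exists w', [/\ H w',
    forall i, (i < M)%N -> nm (w' i) <= t / 2 & spread (11 / 20) (\val (w' n))].
Proof.
move=> t0 Hw wt sw; have [a sa] := @spread_comm _ _ (w n) n2 sw.
have [h [Hh h1 h2]] := eH a.
exists (prodSU_comm w h); split; first exact: (subgroup_comm gH Hw Hh).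
  move=> i iM; rewrite prodSU_comm_coord; apply: le_trans (nm_comm _ _) _.
  have Ki : 2 * ((i.+1 * i.+1)%:R ^+ 2) <= K1 / 2 :> R.
    have -> : K1 / 2 = 2 * ((M * M)%:R ^+ 2) + 1 by rewrite /K1; field.
    rewrite ler_wpDr// ler_pM2l// lerXn2r ?nnegrE ?ler0n//.
    by rewrite ler_nat leq_mul.
  have h1' := h1 i iM; have wt' := wt i iM.
  have p1 : nm (w i) * nm (h i) <= t * e by rewrite ler_pM ?nm_ge0.
  have p2 : K1 * e <= 1 by rewrite mulrC -ler_pdivlMr// div1r.
  apply: (@le_trans _ _ (K1 / 2 * (t * e))).
    by rewrite ler_pM// ?mulr_ge0 ?nm_ge0// exprn_ge0.
  have -> : K1 / 2 * (t * e) = (t / 2) * (K1 * e) by field.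
  by rewrite ler_piMr// divr_ge0.
(* [spread_comm] raises the spread to 3/5, so replacing [a] by [h n] may cost 2/40 and still leaves
   11/20. *)
rewrite prodSU_comm_coord; have -> : 11 / 20 = 3 / 5 - 2 * (1 / 40) :> R by field.
apply: spread_perturb sa _; apply: le_trans (comm_perturb _ _ _) _.
rewrite -/N l1_distC; apply: (@le_trans _ _ ((N ^+ 3 + N ^+ 5) * e)).
  by rewrite ler_wpM2l// addr_ge0// exprn_ge0 ?ler0n.
apply: (@le_trans _ _ ((N ^+ 3 + N ^+ 5) * K2^-1)).
  by rewrite ler_wpM2l// addr_ge0// exprn_ge0 ?ler0n.
by rewrite ler_pdivrMr// /K2; lra.
Qed.

Let spread_sequence : exists w : nat -> prodSU d, forall k, [/\ H (w k),
  forall i, (i < M)%N -> nm (w k i) <= e * 2^-1 ^+ k &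
  spread (11 / 20) (\val (w k n))].
Proof.
have h0 k : 0 <= 2^-1 ^+ k :> R by rewrite exprn_ge0// invr_ge0.
have [a sa] := @exists_spread R n.+1 (ltnW n2).
have [h [Hh h1 h2]] := eH a.
have e40 : e <= 1 / 40.
  apply: le_trans eK2 _; rewrite div1r lef_pV2 ?posrE// /K2.
  by rewrite ler_peMr// lerDr addr_ge0// exprn_ge0 ?ler0n.
have /choice[next nextP] (p : nat * prodSU d) : exists w', H p.2 ->
    (forall i, (i < M)%N -> nm (p.2 i) <= e * 2^-1 ^+ p.1) ->
    spread (11 / 20) (\val (p.2 n)) ->
    [/\ H w', forall i, (i < M)%N -> nm (w' i) <= e * 2^-1 ^+ p.1.+1 &
    spread (11 / 20) (\val (w' n))].
  case: p => k w; have [[Hw wt sw]|nw] := pselect [/\ H w,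
      forall i, (i < M)%N -> nm (w i) <= e * 2^-1 ^+ k & spread (11 / 20) (\val (w n))].
    have [w' [Hw' wt' sw']] := contract (mulr_ge0 e_ge0 (h0 k)) Hw wt sw.
    exists w' => _ _ _; split=> // i iM; have := wt' i iM.
    by rewrite exprS mulrCA mulrC.
  by exists w => Hw wt sw; case: nw.
exists (fix w k := if k is k'.+1 then next (k', w k') else h); elim=> [|k [Hw wt sw]].
  split=> //; first by move=> i iM; rewrite expr0 mulr1; exact: h1.
  have -> : 11 / 20 = 2 - 2 * (29 / 40) :> R by field.
  by apply: spread_perturb sa _; rewrite l1_distC; apply: le_trans h2 _; lra.
exact: (nextP (k, _) Hw wt sw).
Qed.

(* Iterated commutators die out in the first [M] coordinates but not in the [n]th. *)
Lemma nonscalar_tail : exists w, [/\ H w, tail_subgroup M w & nonscalar (\val (w n))].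
Proof.
have [w wP] := spread_sequence.
have [|v Hv clv] := compact_seq_cluster (u := w) cH; first by move=> k; have [] := wP k.
exists v; split => //.
  move=> i iM; apply: nm_eq0; rewrite leNgt; apply/negP => v0.
  have [f f0 fe] := l1_coord_continuous (d := d) i (divr_gt0 v0 (ltr0Sn _ 1)).
  have [k0 k0E] := exp_half_lt e (divr_gt0 v0 (ltr0Sn _ 1)).
  have [k kk kf] := clv f k0 f0.
  have [_ /(_ i iM) wki _] := wP k.
  have ke : e * 2^-1 ^+ k <= e * 2^-1 ^+ k0.
    by rewrite ler_wpM2l// ler_wiXn2l// ?invr_ge0// invf_le1// ler1n.
  have := fe _ _ kf; rewrite l1_distC.
  have : nm (v i) <= l1 (\val (v i) - \val (w k i)) + nm (w k i).
    by apply: le_trans (l1D _ _); rewrite addrA subrK.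
  by move: wki ke k0E; lra.
have [f f0 fe] := l1_coord_continuous (d := d) n (divr_gt0 ltr01 (ltr0Sn R 9)).
have [k _ kf] := clv f 0%N f0; have [_ _ sk] := wP k.
apply: (spread_nonscalar (t := 11 / 20 - 2 * (1 / 10))); first by lra.
by apply: spread_perturb sk _; exact: ltW (fe _ _ kf).
Qed.


(** If one argument of a commutator is within [rho] of 1, the commutator has at most half the norm
    of the other argument, and is small enough to be nonscalar unless it is 1. *)
Let rho : R := (8 * N ^+ 3 * n.+1%:R)^-1.

Hypothesis commutant : forall f : SU R n.+1, nonscalar (\val f) -> exists a : SU R n.+1,
  forall h : SU R n.+1, l1 (\val h - \val a) <= e -> nm h <= rho /\ comm f h <> 1%g.

(** The commutator with a suitable [h] is nontrivial and small, hence again nonscalar, so the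
    construction can be repeated; its first [M] coordinates stay exactly 1. *)
Let shrink w : H w -> tail_subgroup M w -> nonscalar (\val (w n)) ->
  exists w', [/\ H w', tail_subgroup M w', nonscalar (\val (w' n)), w' n <> 1%g &
    nm (w' n) <= 2^-1 * nm (w n)].
Proof.
move=> Hw wM nw; have [a aP] := commutant nw; have [h [Hh _ ha]] := eH a.
have [h1 h2] := aP _ ha.
have n1 : 1 <= n.+1%:R :> R by rewrite ler1n.
have N3 : 1 <= N ^+ 3 by exact: exprn_ege1.
have N2 : 1 <= N ^+ 2 by exact: exprn_ege1.
have r0 : 0 < 8 * N ^+ 3 * n.+1%:R.
  by rewrite !mulr_gt0 ?exprn_gt0// (lt_le_trans ltr01).
have rE : 8 * N ^+ 3 * n.+1%:R * rho = 1 by rewrite mulfV// gt_eqF.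
have rho0 : 0 < rho by rewrite invr_gt0.
have bound : nm (comm (w n) (h n)) <= 2 * N ^+ 2 * (nm (w n) * rho).
  apply: le_trans (nm_comm _ _) _; rewrite -/N ler_wpM2l//.
    by rewrite mulr_ge0// exprn_ge0 ?ler0n.
  by rewrite ler_wpM2l ?nm_ge0.
exists (prodSU_comm w h); split => //.
- exact: (subgroup_comm gH Hw Hh).
- by move=> i iM; rewrite prodSU_comm_coord wM// comm1l.
- rewrite prodSU_comm_coord; apply: small_nonscalar => //.
  have wN : nm (w n) <= N + N by exact: nm_le.
  apply: (@le_lt_trans _ _ (n.+1%:R * (2 * N ^+ 2 * ((N + N) * rho)))).
    rewrite ler_wpM2l ?ler0n//; apply: le_trans bound _.
    rewrite ler_wpM2l//; first by rewrite mulr_ge0// exprn_ge0 ?ler0n.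
    by rewrite ler_wpM2r// ltW.
  have -> : n.+1%:R * (2 * N ^+ 2 * ((N + N) * rho)) =
      (8 * N ^+ 3 * n.+1%:R * rho) / 2 by field.
  by rewrite rE; lra.
- apply: le_trans bound _.
  have -> : 2 * N ^+ 2 * (nm (w n) * rho) = (2 * N ^+ 2 * rho) * nm (w n) by ring.
  rewrite ler_wpM2r ?nm_ge0//.
  have : 4 * N ^+ 2 * rho <= 8 * N ^+ 3 * n.+1%:R * rho.
    rewrite ler_wpM2r ?(ltW rho0)//.
    have : N ^+ 2 <= N ^+ 3 by rewrite ler_weXn2l.
    have : N ^+ 3 <= N ^+ 3 * n.+1%:R by rewrite ler_peMr// exprn_ge0 ?ler0n.
    by lra.
  by rewrite rE; lra.
Qed.

Let small_sequence : exists w : nat -> prodSU d, forall k, [/\ H (w k),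
  tail_subgroup M (w k), w k n <> 1%g & nm (w k n) <= (N + N) * 2^-1 ^+ k].
Proof.
have [w0 [Hw0 w0M w0n]] := nonscalar_tail.
have /choice[next nextP] w : exists w', H w -> tail_subgroup M w ->
    nonscalar (\val (w n)) -> [/\ H w', tail_subgroup M w',
    nonscalar (\val (w' n)), w' n <> 1%g & nm (w' n) <= 2^-1 * nm (w n)].
  have [[Hw wM nw]|nw] := pselect [/\ H w, tail_subgroup M w & nonscalar (\val (w n))].
    by have [w' w'P] := shrink Hw wM nw; exists w'.
  by exists w => Hw wM wn; case: nw.
pose w k := iter k next w0.
have wP k : [/\ H (w k), tail_subgroup M (w k), nonscalar (\val (w k n)) &
    nm (w k n) <= (N + N) * 2^-1 ^+ k].
  elim: k => [|k [Hw wM wn wk]].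
    by split => //; rewrite expr0 mulr1; exact: nm_le.
  have [Hw' wM' wn' _ wk'] := nextP _ Hw wM wn; split=> //.
  by apply: le_trans wk' _; rewrite exprS mulrCA ler_pM2l// invr_gt0.
exists w => k; have [Hw wM wn wk] := wP k; split => //.
by move=> w1; apply: (wn 1); rewrite w1.
Qed.

(* A clopen subset of [W] that contains 1 and has small [n]th coordinates would
   contain the cyclic group of an element whose [n]th coordinate is not 1. *)
Lemma component_tail_nontrivial :
  connected_component (H `&` tail_subgroup M) 1%g <> [set 1%g].
Proof.
set W := H `&` tail_subgroup M => comp1.
have gW : subgroup W by apply: subgroupI => //; exact: subgroup_tail.
have [W1 WM WV] := gW.
have cW : compact W.
  apply: (subclosed_compact _ cH); last by move=> x [].
  apply: closedI; last exact: closed_tail.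
  exact: (compact_closed (@metric_hausdorff _ (prodSU d))).
have [v vP] := small_sequence.
have Wv k : W (v k) by have [] := vP k.
have [x Wx clx] := compact_seq_cluster (u := v) cW Wv.
have x1 : x n = 1%g.
  apply: nm_eq0; rewrite leNgt; apply/negP => x0.
  have [f f0 fe] := l1_coord_continuous (d := d) n (divr_gt0 x0 (ltr0Sn _ 1)).
  have [k0 k0E] := exp_half_lt (N + N) (divr_gt0 x0 (ltr0Sn _ 1)).
  have [k kk kf] := clx f k0 f0; have [_ _ _ vk] := vP k.
  have ke : (N + N) * 2^-1 ^+ k <= (N + N) * 2^-1 ^+ k0.
    rewrite ler_wpM2l//; first by rewrite addr_ge0 ?ler0n.
    by rewrite ler_wiXn2l// ?invr_ge0// invf_le1// ler1n.
  have := fe _ _ kf; rewrite l1_distC.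
  have : nm (x n) <= l1 (\val (x n) - \val (v k n)) + nm (v k n).
    by apply: le_trans (l1D _ _); rewrite addrA subrK.
  by move: vk ke k0E; lra.
have [f f0 fe] := l1_coord_continuous (d := d) n (divr_gt0 ltr01 (ltr0Sn R 1)).
have [||g g0 [V [V1 VU VW sV]]] := @component_saturated_nbhs _ _ W 1%g
    [set y | exists2 a : prodSU d, [set 1%g] a & mdist a y < f] cW W1.
- exact: open_thickening.
- by rewrite comp1 => _ ->; exists 1%g => //; rewrite mdistxx.
have [k _ kg] := clx g 0%N g0; have [_ _ vk1 _] := vP k.
(* The cluster point [x] need not be 1; dividing by it brings [v k] close to 1 without changing
   coordinate [n]. *)
pose y : prodSU d := (v k * x^-1)%g.
have Wy : W y by exact: (WM _ _ (Wv k) (WV _ Wx)).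
have y1 : mdist y 1%g < g by rewrite -(mdist_mulr x) /y mulgVK mul1g.
(* Multiplication by [y] moves every point by less than [g], so the powers of [y] never leave the
   saturated set [V]. *)
have Vy m : V (y ^+ m)%g.
  elim: m => [//|m IH]; apply: sV IH _ _.
    have Wm : W (y ^+ m)%g by elim: (m) => [//|p IHp]; rewrite expgS; exact: WM.
    by rewrite expgS; exact: WM.
  by rewrite expgS -{1}(mul1g (y ^+ m)%g) mdist_mulr metric_sym.
apply: vk1; have <- : y n = v k n.
  by rewrite /y -[LHS]/(v k n * (x n)^-1)%g x1 invg1 mulg1.
apply: no_small_cyclic_subgroup => m.
have [_ -> ym] := VU _ (Vy m).
by have := fe _ _ ym; rewrite expg_coord l1_distC => /ltW.
Qed.

End subgroup.

Lemma component_tail_nontrivial_near : exists2 e : R, 0 < e &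
  forall H, subgroup H -> compact H -> nearly_contains e H ->
    connected_component (H `&` tail_subgroup M) 1%g <> [set 1%g].
Proof.
have n1 : 1 <= n.+1%:R :> R by rewrite ler1n.
have r0 : 0 < (8 * N ^+ 3 * n.+1%:R)^-1.
  by rewrite invr_gt0 !mulr_gt0 ?exprn_gt0// (lt_le_trans ltr01).
have [eta eta0 etaP] := @commutant_scalar R n.+1 _ r0.
exists (Num.min (Num.min K1^-1 K2^-1) eta); first by rewrite !lt_min !invr_gt0 K1_gt0 K2_gt0.
move=> H gH cH nH; apply: (component_tail_nontrivial gH cH nH).
- by rewrite !ge_min lexx.
- by rewrite !ge_min lexx !orbT.
- move=> f /etaP[a aP]; exists a => h; rewrite le_min => /andP[_]; exact: aP.
Qed.

End connected_kernel.

(** * Lie groups have no small subgroups *)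

(** On each axis [m] is the identity near [e], so its differential at [(e, e)] is addition and the
    map from [x] to [m (x, x)] has differential 2. Allowing an error of half of [|x - e|] leaves the
    factor 3/2. *)
Lemma doubling_differential (R : realType) (V : normedModType R) (m : V * V -> V) (e : V) :
  differentiable m (e, e) ->
  (\forall x \near e, m (x, e) = x) -> (\forall y \near e, m (e, y) = y) ->
  \forall x \near e, 3 / 2 * `|x - e| <= `|m (x, x) - e|.
Proof.
move=> dm me em.
have ml v : 'd m (e, e) (v, 0) = v.
  have di : differentiable (fun x : V => (x, e)) e by apply: differentiable_pair.
  have := diff_comp di dm => /(congr1 (@^~ v)) /=.
  rewrite diff_pair//= (@diff_val _ _ _ _ _ _ _ (is_diff_id e)) diff_cst /= => <-.
  rewrite -deriveE; last by apply: differentiable_comp.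
  by rewrite (near_eq_derive v me) derive_id.
have mr v : 'd m (e, e) (0, v) = v.
  have di : differentiable (fun x : V => (e, x)) e by apply: differentiable_pair.
  have := diff_comp di dm => /(congr1 (@^~ v)) /=.
  rewrite diff_pair//= (@diff_val _ _ _ _ _ _ _ (is_diff_id e)) diff_cst /= => <-.
  rewrite -deriveE; last by apply: differentiable_comp.
  by rewrite (near_eq_derive v em) derive_id.
have m2 v : 'd m (e, e) (v, v) = v + v.
  have -> : (v, v) = (v, 0) + (0, v) :> V * V by congr (_, _); rewrite /= ?addr0 ?add0r.
  by rewrite linearD ml mr.
have mee : m (e, e) = e by exact: nbhs_singleton me.
have /eqaddoP/(_ (1 / 2))/= H := diff_locally dm.
have {}H := H (divr_gt0 ltr01 (ltr0Sn _ 1)).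
have : \forall x \near e, `|m (x, x) - e - (x - e) - (x - e)| <= 1 / 2 * `|x - e|.
  have c : (fun x : V => (x - e, x - e)) @ e --> (0 : V * V).
    have -> : (0 : V * V) = ((fun x : V => (x - e, x - e)) e) by rewrite subrr.
    apply: cvg_pair; (apply: cvgB; [exact: cvg_id|exact: cvg_cst]).
  have := c _ H; rewrite nbhs_simpl /=; apply: filterS => x.
  rewrite /= /shift /= -[((_ - _) : _ -> _) _]/(_ - _).
  rewrite -![((_ + _) : _ -> _) _]/(_ + _) /cst /= m2 mee.
  have -> : (x - e, x - e) + (e, e) = (x, x) :> V * V.
    by congr (_, _); rewrite /= subrK.
  rewrite prod_normE /= maxxx; congr (`|_| <= _).
  by rewrite !opprD !addrA.
apply: filterS => x H1.
have := ler_normD (m (x, x) - e) (- (m (x, x) - e - (x - e) - (x - e))).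
rewrite normrN.
have -> : m (x, x) - e - (m (x, x) - e - (x - e) - (x - e)) = (x - e) *+ 2.
  by rewrite mulr2n -[_ - e - _ - _]addrA -opprD subKr.
by rewrite normrMn; move: H1; lra.
Qed.

(* In a chart the squaring map has differential 2 at the identity, so it expands. *)
Lemma lie_group_no_small_subgroups (R : realType) (G : preTopologicalGroupType) :
  is_lie_group R G -> exists2 U : set G, nbhs (1%g : G) U &
    forall g : G, (forall m, U (g ^+ m)%g) -> g = 1%g.
Proof.
move=> [_ _ _ _ [n [atlas [[cover _] smul _]]]].
have [c ac c1] : (\bigcup_(c in atlas) chart_dom c) (1%g : G) by rewrite cover.
pose phi := chart_map c; pose psi := chart_inv c; pose e := phi 1%g.
have psiK g : chart_dom c g -> psi (phi g) = g.
  by move=> cg; apply: (chart_mapK (c := c)); rewrite inE.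
pose m (u : 'rV[R]_n * 'rV[R]_n) := phi (psi u.1 * psi u.2)%g.
have dm : differentiable m (e, e).
  (* The empty list of directions extracts plain differentiability from [smooth_on]. *)
  apply: (smul c c c ac ac ac [::] (e, e)); split => /=.
  - by exists 1%g.
  - by exists 1%g.
  - by rewrite -/psi /e !psiK// mulg1.
have ne : \forall x \near e, (phi @` chart_dom c) x.
  by apply: open_nbhs_nbhs; split; [exact: chart_open_image|exists 1%g].
have me : \forall x \near e, m (x, e) = x.
  by apply: filterS ne => _ [g cg <-]; rewrite /m /= /e !psiK// mulg1.
have em : \forall x \near e, m (e, x) = x.
  by apply: filterS ne => _ [g cg <-]; rewrite /m /= /e !psiK// mul1g.
have /nbhs_ballP[r r0 rP] := doubling_differential dm me em.
exists [set g | chart_dom c g /\ `|phi g - e| < r].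
  have : nbhs (1%g : subspace (chart_dom c)) (phi @^-1` ball e r).
    by apply: (@chart_map_continuous _ _ _ c 1%g); exact: nbhsx_ballx.
  rewrite /nbhs /= -nbhs_subspace_in// /within /= => H; have cn : nbhs (1%g : G) (chart_dom c).
    by apply: open_nbhs_nbhs; split => //; exact: chart_open_dom.
  near=> g; have cg : chart_dom c g by near: g.
  split => //; rewrite distrC.
  suff : ball e r (phi g) by rewrite -ball_normE.
  by move: cg; near: g; exact: H.
move=> g gU.
(* Passing from [h] to [h ^+ 4] is two doublings, which gain the factor 9/4, at least 2; the powers
   of [h ^+ 4] are powers of [h], so the step can be iterated. *)
have H k : forall h, (forall p, chart_dom c (h ^+ p)%g /\ `|phi (h ^+ p)%g - e| < r) ->
    2 ^+ k * `|phi h - e| <= r.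
  elim: k => [|k IH] h hU; first by rewrite mul1r ltW//; have [] := hU 1%N.
  have expand p : 3 / 2 * `|phi (h ^+ p)%g - e| <= `|phi (h ^+ (p + p))%g - e|.
    have [cp pr] := hU p.
    have := rP (phi (h ^+ p)%g); rewrite -ball_normE /= distrC => /(_ pr).
    by rewrite /m /= psiK// -expgnDr.
  have := IH (h ^+ 4)%g; rewrite exprS => /(_ _)/wrap[].
    by move=> p; rewrite -expgnA; exact: hU.
  have := expand 1%N; have := expand 2%N; rewrite expg1 => e2 e1.
  have : 2 * `|phi h - e| <= `|phi (h ^+ 4)%g - e|.
    by have := normr_ge0 (phi h - e); move: e1 e2; lra.
  move=> e4; apply: le_trans; rewrite mulrAC mulrC ler_wpM2l// ?exprn_ge0//.
suff : phi g = e by move=> ge; rewrite -(psiK g) ?ge ?psiK//; have [] := gU 1%N.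
apply/eqP; rewrite -subr_eq0 -normr_le0 leNgt; apply/negP => g0.
have [k _ /(_ k (leqnn k)) /= kE] := near_infty_natSinv_expn_lt (PosNum (divr_gt0 g0 r0)).
have := H k g gU; rewrite leNgt => /negP; apply.
move: kE; rewrite div1r ltr_pdivlMr// mulrC ltr_pdivrMr ?exprn_gt0//.
by rewrite mulrC.
Unshelve. all: by end_near. Qed.

(** * A compact group is its identity component times a Cantor set *)

Section subspaces.

Lemma compact_set_type (X : topologicalType) (A : set X) :
  compact A -> compact [set: set_type A].
Proof.
move=> cA F PF _; have FA : ((set_val : A -> X) @ F) A.
  by apply: (@filterS _ F _ setT); [move=> x _; exact: set_valP|exact: filterT].
have [x [Ax clx]] := cA _ (fmap_proper_filter _ PF) FA.
exists (SigSub (mem_set Ax)); split => // U V FU [_ [[W oW <-] /= Wx] WV].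
have FU' : ((set_val : A -> X) @ F) (set_val @` U).
  by apply: (@filterS _ F _ U) => // u Uu; exists u.
have [z [[u Uu <-] Wz]] := clx _ _ FU' (open_nbhs_nbhs (conj oW Wx)).
by exists u; split => //; exact: WV.
Qed.

Lemma hausdorff_set_type (X : topologicalType) (A : set X) :
  hausdorff_space X -> hausdorff_space (set_type A).
Proof.
move=> hX p q pq; apply: val_inj; apply: hX => U V pU qV.
have [z [Uz Vz]] := pq _ _ (initial_continuous pU) (initial_continuous qV).
by exists (set_val z).
Qed.

Lemma homeomorphic_cantor (R : realType) (X : pseudoMetricType R) (x0 : X) :
  cantor_like X -> homeomorphic X cantor_space.
Proof.
move=> cX.
pose X' : pseudoPMetricType R :=
  HB.pack (PseudoMetric.sort X) (isPointed.Build (PseudoMetric.sort X) x0).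
have [f [cf clf]] := @homeomorphism_cantor_like R X' cX.
exists (f^-1)%FUN, f; split=> [|//||].
- apply/continuous_closedP => A cA; have -> : (f^-1)%FUN @^-1` A = f @` A.
    apply/seteqP; split=> [x /= Ax|_ [a Aa <-]].
      by exists ((f^-1)%FUN x) => //; rewrite invK// inE.
    by rewrite /= funK// inE.
  exact: clf.
- by move=> x; rewrite invK// inE.
- by move=> x; rewrite funK// inE.
Qed.

Lemma continuous_fun_pair (X Y Z : topologicalType) (f : X -> Y) (g : X -> Z) :
  continuous f -> continuous g -> continuous (fun x => (f x, g x)).
Proof. by move=> cf cg x; apply: cvg_pair; [exact: cf|exact: cg]. Qed.

End subspaces.

Section identity_component.
Context {R : realType} {d : forall n, biinvariant_metric R (SU R n.+1)}.
Variable H : set (prodSU d).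
Hypotheses (gH : subgroup H) (cH : compact H).
Implicit Types x y z : prodSU d.

Let H1 : H 1%g. Proof. by case: gH. Qed.
Let HM x y : H x -> H y -> H (x * y)%g. Proof. by case: gH => _ + _; exact. Qed.
Let HV x : H x -> H x^-1%g. Proof. by case: gH => _ _; exact. Qed.

Local Notation cc := (connected_component H).

Lemma mull_continuous (g : prodSU d) : continuous (fun x : prodSU d => (g * x)%g : prodSU d).
Proof.
move=> x U /nbhs_mdist[e e0 eU]; apply/nbhs_mdist; exists e => // y xy.
by apply: eU; rewrite mdist_mull.
Qed.

Lemma mulg_continuous (X : topologicalType) (f g : X -> prodSU d) :
  continuous f -> continuous g -> continuous (fun p => (f p * g p)%g : prodSU d).
Proof.
move=> cf cg p U fgU; have [e e0 eU] := (nbhs_mdist (f p * g p)%g U).1 fgU.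
have e2 : 0 < e / 2 by rewrite divr_gt0.
have F : nbhs p (f @^-1` [set y | mdist (f p) y < e / 2]).
  by apply: cf; apply/nbhs_mdist; exists (e / 2).
have G : nbhs p (g @^-1` [set y | mdist (g p) y < e / 2]).
  by apply: cg; apply/nbhs_mdist; exists (e / 2).
apply: (@filterS _ (nbhs p) _ _ _ _ (filterI F G)) => q [/= fq gq]; apply: eU.
by apply: le_lt_trans (mdist_mul _ _ _ _) _; rewrite [e]splitr ltrD.
Qed.

Lemma continuous_set_type_mdist (f : (H : Type) -> prodSU d) :
  (forall p (e : R), 0 < e -> exists2 r : R, 0 < r & forall q,
    mdist (set_val p) (set_val q) < r -> mdist (f p) (f q) < e) -> continuous f.
Proof.
move=> fe p U fU; have [e e0 eU] := (nbhs_mdist (f p) U).1 fU.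
have [r r0 rf] := fe p e e0.
have nr : nbhs p (set_val @^-1` [set y : prodSU d | mdist (set_val p) y < r]).
  by apply: (@initial_continuous _ _ (set_val : H -> prodSU d)); apply/nbhs_mdist; exists r.
by apply: (@filterS _ (nbhs p) _ _ _ _ nr) => q pq; apply/eU/rf.
Qed.

Lemma component_mull g x y : H g -> cc x y -> cc (g * x)%g (g * y)%g.
Proof.
move=> Hg [A [Ax AH cA] Ay].
exists ((fun x : prodSU d => (g * x)%g : prodSU d) @` A); last by exists y.
split; first by exists x.
- by move=> _ [a Aa <-]; apply: HM => //; exact: AH.
- apply: connected_continuous_connected => //.
  by apply: continuous_subspaceT; exact: mull_continuous.
Qed.

Lemma component_cosetP x y : H x -> cc x y <-> cc 1%g (x^-1 * y)%g.
Proof.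
move=> Hx; split=> [xy|xy].
  by have := component_mull (HV Hx) xy; rewrite mulVg.
by have := component_mull Hx xy; rewrite mulg1 mulVKg.
Qed.

Lemma subgroup_identity_component : subgroup (cc 1%g).
Proof.
have sub := @connected_component_sub _ H 1%g.
split; first exact: connected_component_refl.
- move=> x y x1 y1; apply: (connected_component_trans x1).
  by apply/(component_cosetP _ (sub _ x1)); rewrite mulKg.
- move=> x x1; have /(component_cosetP _ (sub _ x1)) := connected_component_sym x1.
  by rewrite mulg1.
Qed.

(** Left translation by [y x^-1] carries the component of [x] to that of [y] and, by right
    invariance, moves [z] exactly as far as [x] is from [y]. *)
Lemma component_lsc x y z (e : R) : H x -> H y -> cc x z -> mdist x y < e ->
  exists2 w, cc y w & mdist z w < e.
Proof.
move=> Hx Hy xz xy; exists (y * x^-1 * z)%g.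
  have := component_mull (HM Hy (HV Hx)) xz; by rewrite mulgVK.
by rewrite -{1}(mul1g z) mdist_mulr -(mdist_mulr x) mul1g mulgVK.
Qed.

Hypothesis nd : forall e : R, 0 < e -> exists h, [/\ H h, mdist (1%g : prodSU d) h < e & ~ cc 1%g h].

(** With [s] the continuous selection and [T] its image, [x] is sent to the pair of [s(x)^-1 x] and
    [s(x)]; the inverse multiplies the point of [T] by the point of the component. *)
Lemma homeomorphic_component_cantor :
  homeomorphic (H : Type) ((cc 1%g : Type) * cantor_space)%type.
Proof.
have H2 x y : H x -> H y -> mdist x y < 2.
  by move=> _ _; apply: le_lt_trans (mdist_le1 x y) _; rewrite ltr1n.
have [s [sc sE su]] := component_section cH H2 component_lsc.
have sH x : H x -> H (s x) by move=> /sc; exact: connected_component_sub.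
pose T : set (prodSU d) := s @` H.
have TH : T `<=` H by move=> _ [x Hx <-]; exact: sH.
have sT x : T x -> s x = x.
  by move=> [y Hy <-]; rewrite -(sE y (s y))//; exact: sc.
have ccT x y : T x -> T y -> cc x y -> x = y.
  by move=> Tx Ty xy; rewrite -(sT _ Tx) -(sT _ Ty); apply: sE => //; exact: TH.
have cT : compact T.
  apply: continuous_compact => //; apply/subspace_sigL_continuousP.
  apply: continuous_set_type_mdist => p e e0; have [f f0 fs] := su e e0.
  by exists f => // q pq; apply: fs => //; exact: set_valP.
have oval (A : set (T : Type)) (e : R) : 0 < e ->
    (forall p q, A p -> mdist (set_val p) (set_val q) < e -> A q) -> open A.
  move=> e0 Ae; exists [set z | exists2 a, (set_val @` A) a & mdist a z < e].
    exact: open_thickening.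
  apply/seteqP; split=> [y /= [_ [a Aa <-] ay]|y Ay /=]; first exact: Ae ay.
  by exists (set_val y); [exists y|rewrite mdistxx].
have clT : cantor_like (T : Type).
  split.
  - split; first exact: closedT.
    (* Perfectness: for [h] near 1 outside the identity component, [s (t h)] is near [t], and it
       differs from [t] because [t h] lies in another coset. *)
    apply/seteqP; split => // t _ U [_ [[W oW <-] /= Wt] WU].
    have Tt : T (set_val t) by exact: set_valP.
    have /nbhs_mdist[e e0 eW] : nbhs (set_val t) W by exact: open_nbhs_nbhs.
    have [f f0 fs] := su e e0; have [h [Hh h1 nh]] := nd f0.
    have Hth : H (set_val t * h)%g by apply: HM => //; exact: TH.
    have tth : mdist (set_val t) (set_val t * h)%g < f.
      by rewrite -{1}(mulg1 (set_val t)) mdist_mull.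
    have Ts : T (s (set_val t * h)%g) by exists (set_val t * h)%g.
    exists (SigSub (mem_set Ts)); split => //.
      apply/eqP => /(congr1 set_val) /= st; apply: nh.
      have := sc _ Hth; rewrite [s _]st => /(component_cosetP _ Hth).
      rewrite invgM mulgVK.
      have [_ _ +] := subgroup_identity_component.
      by move=> /[apply]; rewrite invgK.
    apply: WU => /=; apply: eW; rewrite -{1}(sT _ Tt).
    by apply: fs => //; exact: TH.
  - exact: compact_set_type.
  - exact/hausdorff_set_type/metric_hausdorff.
  (* Since [T] meets each component once, the component of [x] misses [y]; a saturated set around
     that component is clopen and separates the two points. *)
  - move=> x y xy; have Tx : T (set_val x) by exact: set_valP.
    have Ty : T (set_val y) by exact: set_valP.
    have [||e e0 [V [Vx VU VH sV]]] := @component_saturated_nbhs _ _ H (set_val x)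
      (~` [set set_val y]) cH (TH _ Tx).
    + apply: closed_openC.
      exact: (compact_closed (@metric_hausdorff _ (prodSU d)) (@compact_set1 _ _)).
    + move=> z xz zy; move: xz; rewrite zy => xz.
      by move/eqP: xy; apply; apply: val_inj; exact: ccT.
    exists (set_val @^-1` V); split => //.
      split.
        by apply: (oval _ e) => // a b /= Va; apply: sV => //; exact/TH/set_valP.
      rewrite -openC; apply: (oval _ e) => // a b /= Va ab Vb; apply: Va.
      by apply: sV Vb _ _; [exact/TH/set_valP|rewrite metric_sym].
    by move=> /VU; exact.
have t0 : (T : Type).
  by exists (s 1%g); apply: mem_set; exists 1%g.
have [k [l [ck cl kl lk]]] := homeomorphic_cantor t0 clT.
have fP (x : (H : Type)) : cc 1%g ((s (set_val x))^-1 * set_val x)%g.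
  have Hx : H (set_val x) by exact: set_valP.
  apply/(component_cosetP _ (sH _ Hx)).
  exact/connected_component_sym/sc.
have tP (x : (H : Type)) : T (s (set_val x)) by exists (set_val x) => //; exact: set_valP.
have gP (p : (cc 1%g : Type) * cantor_space) :
    H (set_val (l p.2) * set_val p.1)%g.
  apply: HM; first exact/TH/set_valP.
  by apply: connected_component_sub; exact: set_valP.
exists (fun x : (H : Type) => (SigSub (mem_set (fP x)), k (SigSub (mem_set (tP x))))).
exists (fun p => SigSub (mem_set (gP p))).
split.
- apply: continuous_fun_pair.
    apply: (@continuous_comp_initial _ _ _ (set_val : cc 1%g -> prodSU d)).
    apply: continuous_set_type_mdist => p e e0.
    have [f f0 fs] := su (e / 2) (divr_gt0 e0 (ltr0Sn _ 1)).
    exists (Num.min f (e / 2)); first by rewrite lt_min f0 divr_gt0.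
    move=> q; rewrite lt_min => /andP[pq1 pq2] /=.
    apply: le_lt_trans (mdist_mul _ _ _ _) _; rewrite [e]splitr ltrD// mdist_inv.
    by apply: fs => //; exact: set_valP.
  have cs : continuous (fun x : (H : Type) => SigSub (mem_set (tP x)) : (T : Type)).
    apply: (@continuous_comp_initial _ _ _ (set_val : T -> prodSU d)).
    apply: continuous_set_type_mdist => p e e0; have [f f0 fs] := su e e0.
    by exists f => // q pq /=; apply: fs => //; exact: set_valP.
  by move=> x; exact: (continuous_comp (cs x) (ck _)).
- apply: (@continuous_comp_initial _ _ _ (set_val : H -> prodSU d)).
  apply: mulg_continuous => p.
    apply: (@continuous_comp _ _ _ snd (fun q => set_val (l q))); first exact: cvg_snd.
    by apply: continuous_comp; [exact: cl|exact: initial_continuous].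
  by apply: continuous_comp; [exact: cvg_fst|exact: initial_continuous].
- by move=> x; apply: val_inj => /=; rewrite kl /= mulVKg.
- move=> [c t] /=.
  have Tl : T (set_val (l t)) by exact: set_valP.
  have sl : s (set_val (l t) * set_val c)%g = set_val (l t).
    rewrite -[RHS]sT//; apply/esym/sE; first exact: TH.
    apply/(component_cosetP _ (TH _ Tl)); rewrite mulKg; exact: set_valP.
  congr (_, _); first by apply: val_inj => /=; rewrite sl mulKg.
  by rewrite -[RHS]lk; congr k; apply: val_inj => /=; rewrite sl.
Qed.

End identity_component.

(** * Compactness of SU(n) *)

Section compactness.
Context {R : realType}.
Local Notation C := R[i].

Let square : set C :=
  (fun p : R * R => (p.1 +i* p.2)%C) @` (`[-1, 1]%classic `*` `[-1, 1]%classic).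

Let compact_square : compact square.
Proof.
apply: continuous_compact; last by apply: compact_setX; exact: segment_compact.
apply: continuous_subspaceT => -[a b] U [e /= e0 eU].
have [r r0 er] : exists2 r : R, 0 < r & e = r%:C%C.
  by case: e e0 {eU} => r i; rewrite ltcE /= => /andP[/eqP -> r0]; exists r.
have r2 : 0 < r / 2 by rewrite divr_gt0.
exists (ball a (r / 2), ball b (r / 2)); first by split; exact: nbhsx_ballx.
move=> [x y] [/= ax byy]; apply: eU.
suff H : `|((a +i* b)%C : C) - (x +i* y)%C| < e by exact: H.
rewrite er norm_normc ltcR.
have -> : (a +i* b)%C - (x +i* y)%C = ((a - x) +i* 0)%C + (0 +i* (b - y))%C.
  by apply/eqP; rewrite eq_complex /= addr0 add0r !eqxx.
apply: le_lt_trans (le_normcD _ _) _.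
rewrite /= expr0n /= addr0 add0r !sqrtr_sqr [r]splitr ltrD//.
Qed.

Let cube n : set 'M[C]_n := [set A | forall i j, square (A i j)].

(** Viewing matrices as row vectors of row vectors, compactness of products of compact sets is
    applied twice. *)
Let compact_cube n : compact (@cube n).
Proof.
pose K : set 'rV['rV[C]_n]_n := [set v | forall i, [set w : 'rV[C]_n |
  forall j, square (w ord0 j)] (v ord0 i)].
have cr : compact [set w : 'rV[C]_n | forall j, square (w ord0 j)].
  exact: (@rV_compact _ n (fun=> square) (fun=> compact_square)).
have cK : compact K by exact: (@rV_compact _ n (fun=> _) (fun=> cr)).
pose f (v : 'rV['rV[C]_n]_n) : 'M[C]_n := \matrix_(i, j) v ord0 i ord0 j.
have -> : @cube n = f @` K.
  apply/seteqP; split=> [A cA|_ [v Kv <-] i j]; last by rewrite mxE; exact: Kv.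
  exists (\row_i \row_j A i j).
    by move=> i j; rewrite !mxE.
  by apply/matrixP => i j; rewrite !mxE.
apply: continuous_compact => //; apply: continuous_subspaceT => v U [P Pv PU].
exists (fun _ i => [set w : 'rV[C]_n | forall j, P i j (w ord0 j)]).
  move=> i0 i; rewrite ord1; exists (fun _ j => P i j).
    by move=> j0 j; rewrite ord1; have := Pv i j; rewrite mxE.
  by move=> w Pw j; exact: Pw.
by move=> w Pw; apply: PU => i j; rewrite mxE; exact: Pw.
Qed.

Lemma prod_unimodular (I : finType) (a : I -> C) : (forall i, normc (a i) = 1) ->
  normc (\prod_i a i - 1) <= \sum_i normc (a i - 1).
Proof.
move=> a1; suff [] : normc (\prod_i a i) = 1 /\
  normc (\prod_i a i - 1) <= \sum_i normc (a i - 1) by [].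
elim/big_rec2 : _ => [|i x y _ [y1 yx]]; first by rewrite subrr normc0 normc1.
split; first by rewrite normcM a1 y1 mulr1.
have -> : a i * y - 1 = (a i - 1) * y + (y - 1) by ring.
by apply: le_trans (le_normcD _ _) _; rewrite normcM y1 mulr1 lerD2l.
Qed.

(** The determinant is the product of the eigenvalues, and each eigenvalue minus 1 is an entry of
    [U - 1] conjugated into the eigenbasis. *)
Let det_near1 n (U : 'M[C]_n) : U \is unitarymx ->
  normc (\det U - 1) <= n%:R * ((n * n)%:R * ((n * n)%:R * l1 (U - 1%:M))).
Proof.
move=> uU; have [u [D [uu UE D1]]] := unitary_spectral uU.
have dU : \det U = \prod_i D 0 i.
  by rewrite UE det_mulmx mulrC det_mulmx mulrA -det_mulmx (unitarymxPl uu) det1 mul1r det_diag.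
rewrite dU; apply: le_trans (prod_unimodular _) _ => //.
have DE : diag_mx D - 1%:M = u *m (U - 1%:M) *m u^t*.
  rewrite (mulmxBr u) (mulmxBl _ _ (u^t*)) mulmx1 (unitarymxPl uu) UE !mulmxA.
  rewrite (unitarymxPl uu) mul1mx -(mulmxA _ u) (unitarymxPl uu) mulmx1.
  by [].
have uV : u^t* \is unitarymx by rewrite trmxC_unitary; exact: uu.
have Di i : normc (D 0 i - 1) <= (n * n)%:R * ((n * n)%:R * l1 (U - 1%:M)).
  have -> : D 0 i - 1 = (diag_mx D - 1%:M) i i by rewrite !mxE eqxx !mulr1n.
  apply: le_trans (l1_entry _ _ _) _; rewrite DE.
  apply: le_trans (l1_unitary_mulr _ uV) _.
  by rewrite ler_wpM2l ?ler0n// l1_unitary_mull.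
apply: le_trans (ler_sum _ (fun i _ => Di i)) _.
by rewrite sumr_const card_ord -[leLHS]mulr_natl.
Qed.

Let closed_SU n : closed (@SU_set R n).
Proof.
move=> A cA; pose N : R := (n * n)%:R; have N0 : 0 <= N by exact: ler0n.
have near e : 0 < e -> exists2 B : SU R n, True & l1 (A - \val B) <= N * e.
  move=> e0; have e0' : 0 < e%:C%C by rewrite ltcR.
  have [|B [SB AB]] := cA [set B | forall i j, ball (A i j) e%:C%C (B i j)].
    exists (fun i j => ball (A i j) e%:C%C) => //.
    by move=> i j; exact: nbhsx_ballx.
  exists (mkSU SB.1 SB.2) => //=.
  have -> : N * e = \sum_(i < n) \sum_(j < n) e.
    by rewrite sumr_const sumr_const card_ord -mulrnA mulr_natl.
  apply: ler_sum => i _; apply: ler_sum => j _.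
  have : `|A i j - B i j| < e%:C%C by exact: AB.
  by rewrite norm_normc ltcR !mxE => /ltW.
have le0 (x K : R) : 0 <= K -> (forall e, 0 < e -> x <= K * e) -> x <= 0.
  move=> K0 H; rewrite leNgt; apply/negP => x0.
  have K1 : 0 < K + 1 by rewrite ltr_wpDl.
  have := H _ (divr_gt0 x0 (mulr_gt0 (ltr0Sn _ 1) K1)).
  rewrite mulrA ler_pdivlMr ?mulr_gt0//; nra.
have uA : A \is unitarymx.
  apply/unitarymxP/eqP; rewrite -subr_eq0; apply/eqP/l1_eq0.
  apply: (le0 _ (N * (l1 A) + N * N)) => [|e e0].
    by rewrite addr_ge0// mulr_ge0// l1_ge0.
  have [B _ AB] := near e e0.
  have -> : A *m A^t* - 1%:M = (A - \val B) *m A^t* + \val B *m (A - \val B)^t*.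
    have -> : (A - \val B)^t* = A^t* - (\val B)^t* by rewrite linearB /= map_mxB.
    by rewrite mulmxBl mulmxBr addrA subrK (unitarymxPl (SU_unitary B)).
  apply: le_trans (l1D _ _) _; rewrite mulrDl; apply: lerD.
    apply: le_trans (l1M _ _) _; rewrite l1_trmxC [leRHS]mulrAC.
    by rewrite ler_wpM2r ?l1_ge0.
  apply: le_trans (l1_unitary_mull _ (SU_unitary B)) _.
  by rewrite l1_trmxC -mulrA ler_wpM2l.
split=> //; apply/eqP; rewrite -subr_eq0; apply/eqP/eq0_normc/eqP.
rewrite eq_le normc_ge0 andbT.
apply: (le0 _ (n%:R * (N * (N * (N * N))))) => [|e e0].
  by rewrite !mulr_ge0.
have [B _ AB] := near e e0.
(* Multiplying by the adjoint of the nearby [B], which has determinant 1, reduces the question to a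
   unitary matrix near 1. *)
have -> : \det A = \det ((\val B)^t* *m A).
  have dB : \det ((\val B)^t*) = 1.
    rewrite -val_SUV; by have [] := SU_val_in B^-1%g.
  by rewrite det_mulmx dB mul1r.
have uB : (\val B)^t* \is unitarymx by rewrite trmxC_unitary; exact: SU_unitary.
apply: le_trans (det_near1 (mul_unitarymx uB uA)) _.
rewrite -!mulrA ler_wpM2l// -/N; do 2!apply: ler_wpM2l => //.
have -> : (\val B)^t* *m A - 1%:M = (\val B)^t* *m (A - \val B).
  by rewrite mulmxBr (unitarymxPr (SU_unitary B)).
by apply: le_trans (l1_unitary_mull _ uB) _; rewrite ler_wpM2l.
Qed.

Lemma compact_SU n : compact [set: SU R n].
Proof.
apply: compact_set_type; apply: (subclosed_compact _ (@compact_cube n)); first exact: closed_SU.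
move=> A [uA _] i j; have := unitary_entry i j uA; case: (A i j) => a b ab.
have le x y : `|x| <= normc (x +i* y)%C :> R.
  by rewrite /= -sqrtr_sqr ler_wsqrtr// lerDl sqr_ge0.
exists (a, b) => //; split; rewrite /= in_itv /= -ler_norml.
  exact: le_trans (le a b) ab.
apply: le_trans ab; rewrite /= -sqrtr_sqr ler_wsqrtr// lerDr sqr_ge0//.
Qed.

End compactness.

(** * Density *)

Section density.
Context {R : realType} {d : forall n, biinvariant_metric R (SU R n.+1)}.
Implicit Types (x y z g h : prodSU d) (G : compact_subgroups d).

Lemma hausdorff_dist_le (A B : set (prodSU d)) (r : R) : A !=set0 -> B !=set0 ->
  (forall a, A a -> exists2 b, B b & mdist a b <= r) ->
  (forall b, B b -> exists2 a, A a & mdist b a <= r) -> hausdorff_dist A B <= r.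
Proof.
have ex (P Q : set (prodSU d)) : P !=set0 ->
    (forall a, P a -> exists2 b, Q b & mdist a b <= r) -> excess P Q <= r.
  move=> [a0 Pa0] PQ; apply: ge_sup; first by exists (dist_to a0 Q), a0.
  move=> _ [a Pa <-]; have [b Qb ab] := PQ a Pa; apply: le_trans ab.
  by apply: ge_inf; [exists 0 => _ [c _ <-]; exact: mdist_ge0|exists b].
by move=> A0 B0 AB BA; rewrite /hausdorff_dist ge_max !ex.
Qed.

Lemma hausdorff_dist_lt (A B : set (prodSU d)) (r : R) : B !=set0 ->
  hausdorff_dist A B < r -> forall a, A a -> exists2 b, B b & mdist a b < r.
Proof.
move=> [b0 Bb0] ABr a Aa; have aBr : dist_to a B < r.
  apply: le_lt_trans ABr; rewrite /hausdorff_dist le_max; apply/orP; left.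
  apply: ub_le_sup; last by exists a.
  exists 1 => _ [c _ <-]; apply: le_trans (mdist_le1 c b0).
  by apply: ge_inf; [exists 0 => _ [e _ <-]; exact: mdist_ge0|exists b0].
apply: contrapT => /forall2NP H; move: aBr; rewrite ltNge => /negP; apply.
apply: lb_le_inf; first by exists (mdist a b0), b0.
by move=> _ [b Bb <-]; rewrite leNgt; apply/negP; have [] := H b.
Qed.

Lemma hausdorff_dist_sym (A B : set (prodSU d)) : hausdorff_dist A B = hausdorff_dist B A.
Proof. exact: maxC. Qed.

Lemma subgroup_ofP G :
  [/\ compact (subgroup_of G), subgroup (subgroup_of G) & subgroup_of G !=set0].
Proof.
have [ne cG] : nonempty_compact (subgroup_of G) by exact: set_valP (\val G).
by split => //; exact: (set_valP G).
Qed.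

Lemma nbhs_compact_subgroups G (U : set (compact_subgroups d)) : nbhs G U <->
  exists2 e : R, 0 < e & forall G', hausdorff_dist (subgroup_of G) (subgroup_of G') < e -> U G'.
Proof.
split=> [[_ [[W oW <-] /= WG] WU]|[e e0 eU]].
  have /nbhs_mdist[e e0 eW] : nbhs (set_val G) W by exact: open_nbhs_nbhs.
  by exists e => // G' GG'; apply: WU; exact: eW.
have nW : nbhs (set_val G) [set K : compacts (prodSU d) | mdist (set_val G) K < e].
  by apply/nbhs_mdist; exists e.
apply: (@filterS _ (nbhs G) _ _ _ _ (@initial_continuous _ _
  (set_val : compact_subgroups d -> compacts (prodSU d)) G _ nW)) => G' GG'.
exact: eU.
Qed.

Lemma nowhere_dense_setC (P : set (compact_subgroups d)) :
  (forall G (e : R), 0 < e -> exists2 G',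
    hausdorff_dist (subgroup_of G) (subgroup_of G') < e & nbhs G' P) ->
  nowhere_dense (~` P).
Proof.
move=> HP; rewrite /nowhere_dense -subset0 => G /nbhs_compact_subgroups[e e0 eP].
have [G' GG' nG'] := HP G e e0.
by have [H [nPH PH]] := eP _ GG' _ nG'.
Qed.

Definition trunc N g : prodSU d := fun i => if (i < N)%N then g i else 1%g.

Definition single n (a : SU R n.+1) : prodSU d := dfwith (fun i => 1%g : SU R i.+1) n a.

Let single_in n (a : SU R n.+1) : single a n = a.
Proof. by rewrite /single dfwithin. Qed.

Let single_out n (a : SU R n.+1) i : i != n -> single a i = 1%g.
Proof. by move=> ni; rewrite /single dfwithout// eq_sym. Qed.

Let truncM N g h : trunc N (g * h)%g = (trunc N g * trunc N h)%g.
Proof.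
apply: functional_extensionality_dep => i; rewrite /trunc.
rewrite -[RHS]/((if (i < N)%N then g i else 1) * (if (i < N)%N then h i else 1))%g.
by case: ifP => _; rewrite ?mulg1.
Qed.

Let singleM n (a b : SU R n.+1) : single (a * b)%g = (single a * single b)%g.
Proof.
apply: functional_extensionality_dep => i.
rewrite -[RHS]/(single a i * single b i)%g.
by have [->|ni] := eqVneq i n; rewrite ?single_in ?single_out ?mulg1.
Qed.

Let trunc_single N n g (a : SU R n.+1) : (N <= n)%N ->
  (trunc N g * single a)%g = (single a * trunc N g)%g.
Proof.
move=> Nn; apply: functional_extensionality_dep => i.
rewrite -[LHS]/(trunc N g i * single a i)%g -[RHS]/(single a i * trunc N g i)%g.
have [->|ni] := eqVneq i n; last by rewrite single_out// mulg1 mul1g.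
by rewrite /trunc ltnNge Nn /= mulg1 mul1g.
Qed.

Let trunc1 N : trunc N 1%g = 1%g.
Proof.
apply: functional_extensionality_dep => i; rewrite /trunc.
by case: ifP => _.
Qed.

Let single1 n : single (1%g : SU R n.+1) = 1%g.
Proof.
apply: functional_extensionality_dep => i.
by have [->|ni] := eqVneq i n; rewrite ?single_in ?single_out.
Qed.

Let truncV N g : trunc N g^-1%g = (trunc N g)^-1%g.
Proof. by apply: (mulgI (trunc N g)); rewrite -truncM !mulgV trunc1. Qed.

Let singleV n (a : SU R n.+1) : single a^-1%g = (single a)^-1%g.
Proof. by apply: (mulgI (single a)); rewrite -singleM !mulgV single1. Qed.

(** For [N <= n] the truncations commute with the copy of [L] in the factor of index [n], so
    subgroups give a subgroup; its elements differ from those of [G] only from coordinate [N] on, so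
    it is Hausdorff-close to [G]. *)
Definition splice N n (L : set (SU R n.+1)) G : set (prodSU d) :=
  (fun p : prodSU d * SU R n.+1 => (trunc N p.1 * single p.2)%g : prodSU d) @`
    (subgroup_of G `*` L).

Let splice_subgroup N n (L : set (SU R n.+1)) G : (N <= n)%N -> subgroup L ->
  subgroup (splice N L G).
Proof.
move=> Nn [L1 LM LV]; have [_ [G1 GM GV] _] := subgroup_ofP G; split.
- by exists (1%g, 1%g) => //=; rewrite trunc1 single1 mulg1.
- move=> _ _ [[g a] [/= Gg La] <-] [[h b] [/= Gh Lb] <-].
  exists ((g * h)%g, (a * b)%g); first by split; [exact: GM|exact: LM].
  rewrite /= truncM singleM !mulgA; congr (_ * _)%g.
  by rewrite -!mulgA (trunc_single h a Nn).
- move=> _ [[g a] [/= Gg La] <-]; exists (g^-1%g, a^-1%g).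
    by split; [exact: GV|exact: LV].
  by rewrite /= invgM truncV singleV -truncV -singleV trunc_single.
Qed.

Let trunc_continuous N : continuous (trunc N : prodSU d -> prodSU d).
Proof.
move=> g U tU; have [e e0 eU] := (nbhs_mdist (trunc N g) U).1 tU.
apply/nbhs_mdist; exists e => // h gh; apply/eU/(le_lt_trans _ gh).
apply: mdist_le_coord => i; rewrite /trunc; case: ifP => _ //.
rewrite bidistxx; have := bidist_triangle (d i) (h i) (g i) (g i).
by rewrite bidistxx (bidist_sym _ (h i)) -mulr2n pmulrn_lge0.
Qed.

Let single_continuous n : continuous (@single n : SU R n.+1 -> prodSU d).
Proof.
move=> a U sU; have [e e0 eU] := (nbhs_mdist (single a) U).1 sU.
apply/(bidist_nbhsE (d n)); exists e => // b ab; apply/eU/(le_lt_trans _ ab).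
rewrite -[in leRHS](single_in a) -[in leRHS](single_in b).
by apply: mdist_one_coord => i ni; rewrite !single_out.
Qed.

Let splice_compact N n (L : set (SU R n.+1)) G : compact L -> compact (splice N L G).
Proof.
move=> cL; have [cG _ _] := subgroup_ofP G.
apply: continuous_compact; last exact: compact_setX.
apply: continuous_subspaceT; apply: mulg_continuous => p.
  by apply: (continuous_comp (f := fst)); [exact: cvg_fst|exact: trunc_continuous].
by apply: (continuous_comp (f := snd)); [exact: cvg_snd|exact: single_continuous].
Qed.

Let spliceP N n (L : set (SU R n.+1)) G : (N <= n)%N -> subgroup L -> compact L ->
  exists G', [/\ subgroup_of G' = splice N L G,
    hausdorff_dist (subgroup_of G) (subgroup_of G') <= 2^-1 ^+ N &
    forall a, L a -> subgroup_of G' (single a)].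
Proof.
move=> Nn gL cL; have [L1 _ _] := gL; have [cG [G1 _ _] Gne] := subgroup_ofP G.
have s1 a : L a -> splice N L G (single a).
  by move=> La; exists (1%g, a) => //=; rewrite trunc1 mul1g.
have nc : nonempty_compact (splice N L G).
  by split; [exists (single (1%g : SU R n.+1)); exact: s1|exact: splice_compact].
pose K : compacts (prodSU d) := SigSub (mem_set nc).
have gK : [set K : compacts (prodSU d) | subgroup (\val K)] K.
  exact: splice_subgroup.
pose G' : compact_subgroups d := SigSub (mem_set gK).
have GE : subgroup_of G' = splice N L G by [].
have close g (a : SU R n.+1) : mdist g (trunc N g * single a)%g <= 2^-1 ^+ N.
  apply: mdist_tail => i iN; rewrite -[RHS]/(trunc N g i * single a i)%g.
  have ni : i != n by rewrite neq_ltn (leq_trans iN Nn).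
  have tg : trunc N g i = g i by rewrite /trunc iN.
  by rewrite tg (single_out _ ni) mulg1.
exists G'; split => //; rewrite GE; apply: hausdorff_dist_le => //.
- by have [] := nc.
- move=> g Gg; exists (trunc N g * single (1%g : SU R n.+1))%g; last exact: close.
  by exists (g, 1%g : SU R n.+1) => //; split.
- by move=> _ [[g a] [/= Gg La] <-]; exists g; rewrite // metric_sym; exact: close.
Qed.

Let half_gt0 k : 0 < 2^-1 ^+ k :> R. Proof. by rewrite exprn_gt0// invr_gt0. Qed.

Let half_le k m : (k <= m)%N -> 2^-1 ^+ m <= 2^-1 ^+ k :> R.
Proof. by move=> km; rewrite ler_wiXn2l// ?invr_ge0// invf_le1// ler1n. Qed.

Let half_small (e : R) : 0 < e -> exists k, 2^-1 ^+ k < e.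
Proof. by move=> /(exp_half_lt 1)[k]; rewrite mul1r; exists k. Qed.

Let mdist_single n (a : SU R n.+1) : mdist (1%g : prodSU d) (single a) <= 2^-1 ^+ n.
Proof. by apply: mdist_tail => i ni; rewrite single_out// ltn_eqF. Qed.

(** For all [k] together this says that the identity component is not open; splitting by [k] yields
    countably many conditions. *)
Definition small_disconnected k G := exists h, [/\ subgroup_of G h,
  mdist (1%g : prodSU d) h < 2^-1 ^+ k & ~ connected_component (subgroup_of G) 1%g h].

(** The matrices have even size [n.+1], so -1 has determinant 1. *)
Let SU_opp1 n : odd n -> exists z : SU R n.+1, z <> 1%g /\ (z * z)%g = 1%g.
Proof.
move=> on; have uz : (-1)%:M \is @unitarymx R[i] n.+1 n.+1.
  apply/unitarymxP; rewrite tr_scalar_mx map_scalar_mx -scalar_mxM.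
  by rewrite rmorphN rmorph1 mulrNN mulr1.
have dz : \det ((-1)%:M : 'M[R[i]]_n.+1) = 1.
  by rewrite det_scalar -signr_odd /= on expr0.
exists (mkSU uz dz); split; last first.
  by apply: val_inj; rewrite val_SUM /= -scalar_mxM mulrNN mulr1.
move=> /(congr1 val) /= /matrixP/(_ ord0 ord0); rewrite !mxE eqxx !mulr1n => /eqP.
by rewrite eq_sym -addr_eq0 -mulr2n pnatr_eq0.
Qed.

(** Groups near one spliced with [{1, z}] have coordinates [n] near 1 or near [z] only. The points
    with coordinate near 1 form a saturated set, which confines the identity component. *)
Lemma small_disconnected_dense k : nowhere_dense (~` small_disconnected k).
Proof.
apply: nowhere_dense_setC => G e e0; have [N0 N0e] := half_small e0.
pose N := maxn N0 k.+1; pose n := N.*2.+1.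
have Nn : (N <= n)%N by rewrite /n -addnn -addnS leq_addr.
have on : odd n by rewrite /= odd_double.
have [z [z1 zz]] := SU_opp1 on.
have zV : (z^-1)%g = z by apply: (mulgI z); rewrite mulgV.
have gL : subgroup [set 1%g; z].
  split=> [|x y|x]; first by left.
    by move=> [->|->] [->|->]; rewrite ?mul1g ?mulg1 ?zz; [left|right|right|left].
  by move=> [->|->]; rewrite ?invg1 ?zV; [left|right].
have cL : compact [set 1%g; z] by apply: compactU; exact: compact_set1.
have [G' [G'E GG' G's]] := spliceP G Nn gL cL.
exists G'; first by rewrite (le_lt_trans GG')// (le_lt_trans _ N0e)// half_le// leq_maxl.
have dn_ge0 (x y : SU R n.+1) : 0 <= d n x y.
  have := bidist_triangle (d n) y x x.
  by rewrite bidistxx (bidist_sym _ y x) -mulr2n pmulrn_lge0.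
(* Balls of radius a third of the distance leave a gap of another third, too wide for steps shorter
   than [s]. *)
pose r := d n 1%g z / 3; have r0 : 0 < r.
  rewrite divr_gt0// lt_neqAle dn_ge0 andbT eq_sym; apply/eqP.
  by move=> /bidist_positivity/esym.
(* The first bound controls coordinate [n]; the second, with [n > k], keeps [h] within [2^-1 ^+ k]
   of 1. *)
pose s := Num.min (2^-1 ^+ n.+1 * r) (2^-1 ^+ k.+1).
have s0 : 0 < s by rewrite lt_min mulr_gt0//=; exact: half_gt0.
have coord x y : mdist x y < s -> d n (x n) (y n) < r.
  rewrite lt_min => /andP[+ _] => /(le_lt_trans (mdist_coord x y n)).
  by rewrite ltr_pM2l.
apply/nbhs_compact_subgroups; exists s => // H G'H.
have [cH gH neH] := subgroup_ofP H; have [_ _ neG'] := subgroup_ofP G'.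
have [h Hh zh] := hausdorff_dist_lt neH G'H (G's z (or_intror erefl)).
have hz : d n z (h n) < r by have := coord _ _ zh; rewrite single_in.
have near x : subgroup_of H x -> d n (x n) 1%g < r \/ d n (x n) z < r.
  rewrite hausdorff_dist_sym in G'H => Hx.
  have [y + /coord xy] := hausdorff_dist_lt neG' G'H Hx.
  rewrite G'E => -[[g a] [/= _ La] yE].
  have yn : y n = a.
    rewrite -yE -[LHS]/(trunc N g n * single a n)%g single_in /trunc.
    by rewrite ltnNge Nn /= mul1g.
  by move: xy; rewrite yn; case: La => ->; [left|right].
exists h; split => //.
  apply: (le_lt_trans (metric_triangle _ (single z) _)).
  have zs : mdist (1%g : prodSU d) (single z) <= 2^-1 ^+ k.+1.
    apply: le_trans (mdist_single z) _; apply: half_le.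
    by rewrite (leq_trans _ Nn)// leq_maxr.
  have sk : s <= 2^-1 ^+ k.+1 by rewrite ge_min lexx orbT.
  have -> : 2^-1 ^+ k = 2^-1 ^+ k.+1 + 2^-1 ^+ k.+1 :> R by rewrite exprS; field.
  by move: zh; lra.
pose V : set (prodSU d) := [set x | subgroup_of H x /\ d n (x n) 1%g < r].
have VH : connected_component (subgroup_of H) 1%g `<=` V.
  apply: (component_saturated_sub s0).
    by split; [case: gH|rewrite -[X in d n X _]/(1%g) bidistxx].
  move=> x y [Hx x1] Hy /coord xy; split => //.
  have [//|yz] := near y Hy.
  have := bidist_triangle (d n) (x n) 1%g z; rewrite (bidist_sym _ 1%g (x n)).
  have := bidist_triangle (d n) (y n) (x n) z.
  have : d n 1%g z = 3 * r by rewrite /r; field.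
  by move: x1 xy yz; lra.
move=> /VH[_ h1].
have := bidist_triangle (d n) (h n) 1%g z.
rewrite (bidist_sym _ 1%g (h n)) (bidist_sym _ (h n) z).
have : d n 1%g z = 3 * r by rewrite /r; field.
by move: h1 hz r0; lra.
Qed.

Definition tail_connected k G :=
  connected_component (subgroup_of G `&` @tail_subgroup R d k) 1%g <> [set 1%g].

Let l1_coords_continuous n (e : R) : 0 < e -> exists2 f : R, 0 < f &
  forall i x y, (i <= n)%N -> mdist x y < f -> l1 (\val (x i) - \val (y i)) < e.
Proof.
move=> e0; elim: n => [|n [f f0 fe]].
  have [f f0 fe] := l1_coord_continuous (d := d) 0%N e0; exists f => // i x y.
  by rewrite leqn0 => /eqP ->; exact: fe.
have [g g0 ge] := l1_coord_continuous (d := d) n.+1 e0.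
exists (Num.min f g); first by rewrite lt_min f0.
move=> i x y; rewrite leq_eqVlt lt_min => /orP[/eqP ->|ilt] /andP[xf xg]; first exact: ge.
exact: fe.
Qed.

(** Splicing in the whole factor of index [n] makes every group near the result satisfy
    [nearly_contains]. *)
Lemma tail_connected_dense k : nowhere_dense (~` tail_connected k).
Proof.
apply: nowhere_dense_setC => G e e0; have [N0 N0e] := half_small e0.
pose N := maxn N0 k.
(* The commutator argument needs matrices of size [n.+1] at least 3. *)
have [n [Nn n2]] : exists n, (N <= n)%N /\ (1 < n)%N.
  by exists (N + 2)%N; rewrite leq_addr addn2.
have [r r0 rP] := component_tail_nontrivial_near (d := d) k n2.
have gT : subgroup [set: SU R n.+1] by [].
have [G' [_ GG' G's]] := spliceP G Nn gT (@compact_SU R n.+1).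
exists G'; first by rewrite (le_lt_trans GG')// (le_lt_trans _ N0e)// half_le// leq_maxl.
have [f f0 fr] := l1_coords_continuous n r0.
apply/nbhs_compact_subgroups; exists f => // H G'H.
have [cH gH neH] := subgroup_ofP H.
apply: rP => // a; have [h Hh ah] := hausdorff_dist_lt neH G'H (G's a I).
have kn : (k <= n)%N by rewrite (leq_trans _ Nn)// leq_maxr.
exists h; split => //.
  move=> i ik; have := fr i _ _ (leq_trans (ltnW ik) kn) ah.
  have ni : i != n by rewrite neq_ltn (leq_trans ik kn).
  rewrite (single_out a ni) l1_distC val_SU1 -/(nm (h i)); exact: ltW.
have := fr n _ _ (leqnn n) ah; rewrite (single_in a) l1_distC; exact: ltW.
Qed.

Lemma tail_connected_component k G : tail_connected k G -> exists x, [/\ x <> 1%g,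
  @tail_subgroup R d k x & connected_component (subgroup_of G) 1%g x].
Proof.
move=> kG; have [_ gG _] := subgroup_ofP G.
have gW := subgroupI gG (subgroup_tail (d := d) k).
apply: contrapT => /forallNP H; apply: kG; apply/seteqP; split=> [x x1|_ ->].
  apply: contrapT => nx; apply: (H x); split => //.
    by have [] := connected_component_sub x1.
  case: x1 => A [A1 AW cA] Ax; exists A => //; split => //.
  by move=> y /AW[].
by apply: connected_component_refl; case: gW.
Qed.

End density.

Section subgroup_type_facts.
Context (G : preTopologicalGroupType) (H : set G) (gH : subgroup H).

Lemma val_subgroup_expg (g : subgroup_type gH) m : \val (g ^+ m)%g = (\val g ^+ m)%g.
Proof. by elim: m => [//|m IH]; rewrite !expgS -IH. Qed.

End subgroup_type_facts.

Theorem theorem5p23 (R : realType)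
    (d : forall n : nat, biinvariant_metric R (SU R n.+1)) :
  comeager [set G : compact_subgroups d |
    let G0 := connected_component (subgroup_of G) 1%g in
    homeomorphic (subgroup_of G : Type) (G0 * cantor_space)%type /\
    exists G0_subgroup : subgroup G0,
      [/\ G0 <> [set 1%g], connected G0 &
        ~ is_lie_group R (subgroup_type G0_subgroup)]].
Proof.
(* The two countable families of conditions are interleaved by parity. *)
exists (fun n => ~` (if odd n then @small_disconnected R d n./2 else @tail_connected R d n./2)).
  by move=> n; case: ifP => _; [exact: small_disconnected_dense|exact: tail_connected_dense].
move=> G nG; apply: contrapT => nF; apply: nG.
have {}nF n : (if odd n then @small_disconnected R d n./2 else @tail_connected R d n./2) G.
  by apply: contrapT => nGn; apply: nF; exists n.
have sd k : small_disconnected k G.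
  by have := nF k.*2.+1; rewrite /= odd_double /= uphalf_double.
have tc k : tail_connected k G.
  by have := nF k.*2; rewrite odd_double doubleK.
have [cG gG neG] := subgroup_ofP G.
split.
  apply: homeomorphic_component_cantor => // e e0.
  have [k] := exp_half_lt 1 e0; rewrite mul1r => ke.
  have [h [Gh h1 nh]] := sd k; exists h; split => //.
  exact: lt_trans h1 ke.
exists (subgroup_identity_component gG); split.
- move=> G01; have [x [x1 _]] := tail_connected_component (tc 0%N).
  by rewrite G01.
- exact: component_connected.
- move=> /lie_group_no_small_subgroups[U [_ [[W oW <-] /= W1] WU] nss].
  have /nbhs_mdist[e e0 eW] : nbhs (1%g : prodSU d) W by exact: open_nbhs_nbhs.
  have [k] := exp_half_lt 1 e0; rewrite mul1r => ke.
  (* All powers of an element that is trivial in the first [k] coordinates are within [2^-1 ^+ k] of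
     1, hence in [W], which contradicts the absence of small subgroups. *)
  have [x [x1 xk xG]] := tail_connected_component (tc k).
  apply: x1; pose g : subgroup_type (subgroup_identity_component gG) :=
    SigSub (mem_set xG).
  suff /(congr1 \val) : g = 1%g by [].
  apply: nss => m; apply: WU => /=; apply: eW; apply: le_lt_trans ke.
  apply: mdist_tail => i ik.
  have -> : set_val (g ^+ m)%g = (x ^+ m)%g by exact: val_subgroup_expg.
  by rewrite expg_coord xk// expg1n.
Qed.
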